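(* Let $k$ be an algebraically closed field of arbitrary characteristic $p\ge 0$. Every nonsingular cubic surface in $\mathbb{P}^3_k$ is projectively isomorphic to a surface in $\mathbb{P}^3_k$ given by an equation of the form $$x_0x_1(x_0 + x_1 + a_3x_2 + a_2x_3) + x_2x_3(a_1x_0 + a_0x_1 + x_2+x_3) = 0$$ for some parameters $a_0,a_1,a_2,a_3\in k$.
   Context: $x_0,x_1,x_2,x_3$ are homogeneous coordinates of $\mathbb{P}^3_k$. Two surfaces in $\mathbb{P}^3_k$ are projectively isomorphic if some element of $\mathrm{PGL}_4(k)$ maps one onto the other. *)

(* Defs.v *)
From HB Require Import structures.
From mathcomp Require Import all_boot all_order all_algebra.
From mathcomp Require Export mpoly.

Set Implicit Arguments.
Unset Strict Implicit.
Unset Printing Implicit Defensive.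

Import GRing.Theory.

Local Open Scope ring_scope.

Section ProjectiveSurfaces.

Variable k : fieldType.

Implicit Types (F G : {mpoly k[4]}) (x y : 'cV[k]_4) (A : 'M[k]_4).

(* Points of P^3 are represented by nonzero column vectors of homogeneous
   coordinates, elements of PGL_4(k) by invertible 4 x 4 matrices, and surfaces
   by homogeneous forms; everything below is invariant under nonzero scalars. *)

Definition cubic_form F : Prop := F != 0 /\ F \is 3.-homog.

Definition on_surface F x : Prop := x != 0 /\ F.@[fun i => x i 0] = 0.

(* Jacobian criterion at the k-points, meant for k algebraically closed.
   The condition that F vanishes at x cannot be dropped: Euler's relation does
   not give it when the characteristic divides the degree. *)
Definition nonsingular F : Prop :=
  forall x, on_surface F x -> exists i : 'I_4, (F^`M(i)).@[fun j => x j 0] != 0.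

(* G(A x), as a polynomial in the coordinates of x. *)
Definition pullback A G : {mpoly k[4]} :=
  G \mPo [tuple \sum_(j < 4) A i j *: 'X_j | i < 4].

(* The transformation A maps the surface F = 0 onto the surface G = 0: the first
   conjunct is the equality of point sets, the second one the equality of closed
   subschemes, so that multiplicities of components are respected too. *)
Definition maps_onto A F G : Prop :=
  (forall y, on_surface G y <-> exists2 x, on_surface F x & y = A *m x) /\
  (exists2 c : k, c != 0 & pullback A G = c *: F).

Definition projectively_isomorphic F G : Prop :=
  exists2 A : 'M[k]_4, A \in unitmx & maps_onto A F G.

Definition normal_form (a0 a1 a2 a3 : k) : {mpoly k[4]} :=
  let x0 := 'X_0 in let x1 := 'X_1 in
  let x2 := 'X_(2%:R) in let x3 := 'X_(3%:R) in
  x0 * x1 * (x0 + x1 + a3 *: x2 + a2 *: x3) +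
  x2 * x3 * (a1 *: x0 + a0 *: x1 + x2 + x3).

End ProjectiveSurfaces.

(* Main.v *)
(* The surface contains a line.  At a point p the tangent plane cuts the surface
   in a cubic curve singular at p; if that curve contains no line, it is a nodal
   or cuspidal cubic with a rational parametrization.  The lines through a moving
   point of the curve and contained in its tangent plane are the common zeros of a
   binary quadratic and a binary cubic form, whose resultant is a polynomial of
   degree 27 in the parameter without zero at the singular point, so that it
   vanishes somewhere.

   The planes through a line l cut the surface in l and a conic, whose
   half-discriminant is a binary quintic form in the plane.  Hence some plane cuts
   it in three lines l, m, n.  Smoothness makes this root of the quintic simple,
   so that l and m lie in further tritangent planes z = 0 and y = 0.  With t = 0
   the plane of l, m, n, the forms F|(z=0) and F|(y=0) are t times two linear
   forms, which agree on y = z = 0 and therefore glue to linear forms m2, m3 with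
   F - t m2 m3 divisible by y z: F = y z l3 + t m2 m3.  In the coordinates
   y, z, t, m2, smoothness at the four coordinate points makes the coefficients
   that have to be 1 nonzero, and a diagonal change of coordinates finishes. *)

Require Import Defs.
From mathcomp Require Import all_boot all_order all_algebra.
From mathcomp Require Import ring.

Set Implicit Arguments.
Unset Strict Implicit.
Unset Printing Implicit Defensive.

Import GRing.Theory.
Local Open Scope ring_scope.

(** Proof by ideal membership: applied once per hypothesis with its multiplier, it leaves an
    identity for [ring]. *)
Lemma eq_lincomb (R : comNzRingType) (m u v x y : R) :
  u = v -> x - y = m * (u - v) -> x = y.
Proof. by move=> ->; rewrite subrr mulr0 => /subr0_eq. Qed.

(** * Polynomial functions and binary forms *)

Section PolynomialFunctions.

Variable k : closedFieldType.
Implicit Types (f g : k -> k) (p q : {poly k}).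

(** Functions, not polynomials, so that the trilinear form is only ever evaluated at vectors over
    [k]. *)
Definition polyfun f : Prop := exists p, forall x, f x = p.[x].

Lemma polyfun_id : polyfun id.
Proof. by exists 'X => x; rewrite hornerX. Qed.

Lemma polyfun_const c : polyfun (fun=> c).
Proof. by exists c%:P => x; rewrite hornerC. Qed.

Lemma polyfunD f g : polyfun f -> polyfun g -> polyfun (fun x => f x + g x).
Proof. by move=> [p fE] [q gE]; exists (p + q) => x; rewrite hornerD fE gE. Qed.

Lemma polyfunM f g : polyfun f -> polyfun g -> polyfun (fun x => f x * g x).
Proof. by move=> [p fE] [q gE]; exists (p * q) => x; rewrite hornerM fE gE. Qed.

Lemma polyfunN f : polyfun f -> polyfun (fun x => - f x).
Proof. by move=> [p fE]; exists (- p) => x; rewrite hornerN fE. Qed.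

Lemma polyfunX f n : polyfun f -> polyfun (fun x => f x ^+ n).
Proof. by move=> [p fE]; exists (p ^+ n) => x; rewrite horner_exp fE. Qed.

(* If p has no root it is a constant c, so that q agrees with kappa c 'X^n at
   all nonzero points, hence also at 0. *)
Lemma root_of_reciprocal f g (kappa : k) n :
  polyfun f -> polyfun g -> (0 < n)%N ->
  (forall b, b != 0 -> g b = kappa * b ^+ n * f b^-1) ->
  g 0 != 0 -> exists a, f a = 0.
Proof.
move=> [p fE] [q gE] n_gt0 gf g0.
case: (boolP (size p == 1)) => [/size_poly1P[c _ pc]|]; last first.
  by move=> /closed_rootP[a /rootP pa]; exists a; rewrite fE.
(* The factor ['X] makes a nonroot b nonzero, where [gf] applies. *)
case: (eqVneq ('X * (q - (kappa * c) *: 'X^n)) 0) => [|/closed_nonrootP[b]].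
  move=> /eqP; rewrite mulf_eq0 polyX_eq0 /= subr_eq0 => /eqP qE.
  by move: g0; rewrite gE qE hornerZ hornerXn expr0n gtn_eqF // mulr0 eqxx.
rewrite /root hornerM hornerX mulf_eq0 negb_or => /andP[b0].
rewrite hornerD hornerN hornerZ hornerXn -gE gf // fE pc hornerC.
by rewrite -mulrA [b ^+ n * c]mulrC mulrA subrr eqxx.
Qed.

Lemma quadratic_root (a b c : k) : a != 0 ->
  exists x, a * x ^+ 2 + b * x + c = 0.
Proof.
move=> a0; have [x] := solve_monicpoly (fun i => [:: - c / a; - b / a]`_i) (isT : (0 < 2)%N).
by rewrite !big_ord_recr big_ord0 /= => xE; exists x; rewrite xE; field.
Qed.

Lemma binary_quadratic_factor (a b c : k) :
  exists p0 p1 q0 q1 : k,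
    [/\ a = p0 * q0, b = p0 * q1 + p1 * q0 & c = p1 * q1].
Proof.
case: (eqVneq a 0) => [->|a0].
  by exists 0, 1, b, c; split; ring.
have [x xE] := quadratic_root b c a0.
exists 1, (- x), a, (a * x + b); split; try ring.
by apply: (eq_lincomb (m := 1) xE); ring.
Qed.

Lemma cubic_root (a b c d : k) : a != 0 ->
  exists x, a * x ^+ 3 + b * x ^+ 2 + c * x + d = 0.
Proof.
move=> a0.
have [x] := solve_monicpoly (fun i => [:: - d / a; - c / a; - b / a]`_i) (isT : (0 < 3)%N).
by rewrite !big_ord_recr big_ord0 /= => xE; exists x; rewrite xE; field.
Qed.

Lemma nth_root n (c : k) : (0 < n)%N -> exists x, x ^+ n = c.
Proof.
case: n => // n _; have [x] := solve_monicpoly (fun i => [:: c]`_i) (ltn0Sn n).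
rewrite big_ord_recl big1 => [|i _]; last by rewrite /= nth_nil mul0r.
by rewrite /= expr0 mulr1 addr0 => xE; exists x.
Qed.

Lemma binary_quadratic_zero (a b c : k) : exists x y : k,
  (x != 0) || (y != 0) /\ a * x ^+ 2 + b * x * y + c * y ^+ 2 = 0.
Proof.
case: (eqVneq a 0) => [->|a0]; first by exists 1, 0; rewrite oner_eq0; split; [|ring].
have [x xE] := quadratic_root b c a0.
by exists x, 1; rewrite oner_eq0 orbT; split=> //; rewrite -[RHS]xE; ring.
Qed.

Lemma binary_cubic_zero (a b c d : k) : exists x y : k,
  (x != 0) || (y != 0) /\
  a * x ^+ 3 + b * x ^+ 2 * y + c * x * y ^+ 2 + d * y ^+ 3 = 0.
Proof.
case: (eqVneq a 0) => [->|a0]; first by exists 1, 0; rewrite oner_eq0; split; [|ring].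
have [x xE] := cubic_root b c d a0.
by exists x, 1; rewrite oner_eq0 orbT; split=> //; rewrite -[RHS]xE; ring.
Qed.

(** The expanded resultant of the binary quadratic form b and the binary cubic form c. *)
Definition res23 (b0 b1 b2 c0 c1 c2 c3 : k) : k :=
  c0 ^+ 2 * b2 ^+ 3 + c1 ^+ 2 * b0 * b2 ^+ 2 + c2 ^+ 2 * b0 ^+ 2 * b2
  + c3 ^+ 2 * b0 ^+ 3 - c0 * c1 * b2 ^+ 2 * b1
  + c0 * c2 * b2 * (b1 ^+ 2 - 2%:R * b0 * b2)
  - c0 * c3 * (b1 ^+ 3 - 3%:R * b0 * b1 * b2) - c1 * c2 * b0 * b1 * b2
  + c1 * c3 * b0 * (b1 ^+ 2 - 2%:R * b0 * b2) - c2 * c3 * b0 ^+ 2 * b1.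

(** The resultant is the product of the values of the cubic at the zeros (p1, -p0) and (q1, -q0) of
    the linear factors of the quadratic. If a factor is zero, any zero of the cubic will do. *)
Lemma res23_common_zero (b0 b1 b2 c0 c1 c2 c3 : k) :
  res23 b0 b1 b2 c0 c1 c2 c3 = 0 ->
  exists x y : k, [/\ (x != 0) || (y != 0),
    b0 * x ^+ 2 + b1 * x * y + b2 * y ^+ 2 = 0 &
    c0 * x ^+ 3 + c1 * x ^+ 2 * y + c2 * x * y ^+ 2 + c3 * y ^+ 3 = 0].
Proof.
have [p0 [p1 [q0 [q1 [-> -> ->]]]]] := binary_quadratic_factor b0 b1 b2.
case: (boolP ((p1 != 0) || (- p0 != 0))) => [pn0|]; last first.
  rewrite oppr_eq0 negb_or !negbK => /andP[/eqP-> /eqP->] _.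
  have [x [y [xy0 cxy]]] := binary_cubic_zero c0 c1 c2 c3.
  by exists x, y; split=> //; ring.
case: (boolP ((q1 != 0) || (- q0 != 0))) => [qn0|]; last first.
  rewrite oppr_eq0 negb_or !negbK => /andP[/eqP-> /eqP->] _.
  have [x [y [xy0 cxy]]] := binary_cubic_zero c0 c1 c2 c3.
  by exists x, y; split=> //; ring.
pose C x y := c0 * x ^+ 3 + c1 * x ^+ 2 * y + c2 * x * y ^+ 2 + c3 * y ^+ 3.
have -> : res23 (p0 * q0) (p0 * q1 + p1 * q0) (p1 * q1) c0 c1 c2 c3 =
  C p1 (- p0) * C q1 (- q0) by rewrite /res23 /C; ring.
move=> /eqP; rewrite mulf_eq0 => /orP[/eqP Cp|/eqP Cq].
  by exists p1, (- p0); split=> //; ring.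
by exists q1, (- q0); split=> //; ring.
Qed.

(* The half-discriminant: it detects degenerate conics in characteristic 2 too. *)
Definition conic_disc (R : comNzRingType) (a b c d e f : R) : R :=
  4%:R * a * c * f + b * d * e - a * e ^+ 2 - c * d ^+ 2 - f * b ^+ 2.

(** The conic is a X^2 + b X Y + c Y^2 + d X Z + e Y Z + f Z^2. *)
Definition conic_splits (a b c d e f : k) : Prop :=
  exists p0 p1 p2 q0 q1 q2 : k,
    [/\ [/\ a = p0 * q0, b = p0 * q1 + p1 * q0 & c = p1 * q1],
        d = p0 * q2 + p2 * q0, e = p1 * q2 + p2 * q1 & f = p2 * q2].

(** Here (1 : 0 : 0) lies on the conic. If b or d is nonzero, the tangent b Y + d Z at this point is
    a component; otherwise only Y and Z occur. *)
Lemma conic_splits_isotropic (b c d e f : k) :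
  conic_disc 0 b c d e f = 0 -> conic_splits 0 b c d e f.
Proof.
rewrite /conic_disc => disc0.
case: (eqVneq b 0) => [b0|b0].
  case: (eqVneq d 0) => [d0|d0].
    have [p1 [p2 [q1 [q2 [-> -> ->]]]]] := binary_quadratic_factor c e f.
    by exists 0, p1, p2, 0, q1, q2; rewrite b0 d0; split; [split|..]; ring.
  exists 0, b, d, 1, (e / d), (f / d).
  have c0 : c = 0.
    have : c * d ^+ 2 = 0.
      by apply: (eq_lincomb (m := -1) disc0); rewrite b0; ring.
    by move/eqP; rewrite mulf_eq0 expf_eq0 (negPf d0) orbF => /eqP.
  by rewrite b0 c0; split; [split|..]; field.
have fE : f = (b * d * e - c * d ^+ 2) / b ^+ 2.
  apply: (mulIf (expf_neq0 2 b0)); rewrite divfK ?expf_neq0 //.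
  by apply: (eq_lincomb (m := -1) disc0); rewrite /conic_disc; ring.
exists 0, b, d, 1, (c / b), ((e - d * c / b) / b).
by split; [split|..]; rewrite ?fE; field.
Qed.

(** For a nonzero, (r : 1 : 0) is a point of the conic, and X = r S + T, Y = S moves it to (1 : 0 :
    0). *)
Lemma conic_disc0_splits (a b c d e f : k) :
  conic_disc a b c d e f = 0 -> conic_splits a b c d e f.
Proof.
move=> disc0; case: (eqVneq a 0) => [a0|a0].
  by move: disc0; rewrite a0; apply: conic_splits_isotropic.
have [r rE] := quadratic_root b c a0.
have : conic_splits 0 (2%:R * a * r + b) a (d * r + e) d f.
  by apply: conic_splits_isotropic; apply: (eq_lincomb (m := 1) disc0);
  apply: (eq_lincomb (m := - 4%:R * a * f + d ^+ 2) rE); rewrite /conic_disc; ring.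
move=> [p1 [p0 [p2 [q1 [q0 [q2 [[E1 E2 E3] E4 E5 E6]]]]]]].
exists p0, (p1 - r * p0), p2, q0, (q1 - r * q0), q2.
have bE : b = p1 * q0 + p0 * q1 - 2%:R * p0 * q0 * r.
  by apply: (eq_lincomb (m := 1) E2); rewrite E3; ring.
have eE : e = p1 * q2 + p2 * q1 - (p0 * q2 + p2 * q0) * r.
  by apply: (eq_lincomb (m := 1) E4); rewrite E5; ring.
split; [split|..]; rewrite ?E3 ?bE ?E5 ?E6 ?eE //; try ring.
by apply: (eq_lincomb (m := 1) rE); apply: (eq_lincomb (m := 1) E1); rewrite bE E3; ring.
Qed.

(** Unique factorization of binary quadratic forms; it will align the factors of two plane sections
    along their common line. *)
Lemma binary_factors_match (p0 p2 q0 q2 p0' p2' q0' q2' : k) :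
  p0 * q0 != 0 -> p0 * q0 = p0' * q0' ->
  p0 * q2 + p2 * q0 = p0' * q2' + p2' * q0' -> p2 * q2 = p2' * q2' ->
  exists2 c : k, c != 0 &
    ([/\ p0' = c * p0, p2' = c * p2, q0' = q0 / c & q2' = q2 / c] \/
     [/\ q0' = c * p0, q2' = c * p2, p0' = q0 / c & p2' = q2 / c]).
Proof.
move=> pq0 E0 E1 E2; move: (pq0); rewrite E0.
move: (pq0); rewrite !mulf_eq0 !negb_or => /andP[p00 q00] /andP[p0'0 q0'0].
(* This is the value of the second product at the zero (-p2, p0) of the first factor. *)
have : (p2' * p0 - p0' * p2) * (q2' * p0 - q0' * p2) = 0.
  apply: (eq_lincomb (m := - p2 ^+ 2) E0).
  apply: (eq_lincomb (m := p0 * p2) E1).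
  by apply: (eq_lincomb (m := - p0 ^+ 2) E2); ring.
move/eqP; rewrite mulf_eq0 !subr_eq0 => /orP[/eqP H|/eqP H].
  exists (p0' / p0); first by rewrite mulf_neq0 ?invr_neq0.
  have H2 : p2' = p0' * p2 / p0 by rewrite -H mulfK.
  have Hq : q0 = p0' * q0' / p0 by rewrite -E0; field.
  left; split; rewrite ?H2 ?Hq; try by field; rewrite ?p00 ?p0'0.
  apply: (mulfI p0'0); apply: (addIr (p2' * q0')); rewrite -E1 H2 Hq.
  by field; rewrite ?p00 ?p0'0.
exists (q0' / p0); first by rewrite mulf_neq0 ?invr_neq0.
have H2 : q2' = q0' * p2 / p0 by rewrite -H mulfK.
have Hq : q0 = p0' * q0' / p0 by rewrite -E0; field.
right; split; rewrite ?H2 ?Hq; try by field; rewrite ?p00 ?q0'0.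
apply: (mulIf q0'0); apply: (addrI (p0' * q2')); rewrite -E1 H2 Hq.
by field; rewrite ?p00 ?q0'0.
Qed.

End PolynomialFunctions.

Ltac polyfun_tac :=
  do ![assumption|exact: polyfun_const|exact: polyfun_id|apply: polyfunN
      |apply: polyfunD|apply: polyfunM|apply: polyfunX].

(** * Cubic forms and their polarization *)

Section CubicForms.

Variables (k : closedFieldType) (V : vectType k).

Record trilinear := Trilinear {
  tri :> V -> V -> V -> k;
  triP1 : forall a x x' y z, tri (a *: x + x') y z = a * tri x y z + tri x' y z;
  triP2 : forall a x y y' z, tri x (a *: y + y') z = a * tri x y z + tri x y' z;
  triP3 : forall a x y z z', tri x y (a *: z + z') = a * tri x y z + tri x y z' }.

Implicit Types (t : trilinear) (u v w : V).

(* A cubic form is written as t x x x with t trilinear, not necessarily symmetric.  Its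
   polarization, free of divisions: [polar t x y] is the derivative at x in the
   direction y, [polar3] the full symmetric trilinear form. *)
Definition cub t x := t x x x.
Definition polar t x y := t y x x + t x y x + t x x y.
Definition polar3 t x y z :=
  t x y z + t y z x + t z x y + t x z y + t y x z + t z y x.

Lemma polar_self t v : polar t v v = 3%:R * cub t v.
Proof. by rewrite /polar /cub; ring. Qed.

(** Combinations of fewer vectors are written with zeros in the spare places, so that the expansions
    below serve every case. *)
Definition lc4 u1 u2 u3 u4 a1 a2 a3 a4 : V :=
  a1 *: u1 + (a2 *: u2 + (a3 *: u3 + a4 *: u4)).

Lemma tri0 t : [/\ forall y z, t 0 y z = 0, forall x z, t x 0 z = 0 &
  forall x y, t x y 0 = 0].
Proof.
split=> [y z|x z|x y].
- by have := triP1 t (-1) 0 0 y z; rewrite scaler0 addr0 mulN1r addNr.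
- by have := triP2 t (-1) x 0 0 z; rewrite scaler0 addr0 mulN1r addNr.
- by have := triP3 t (-1) x y 0 0; rewrite scaler0 addr0 mulN1r addNr.
Qed.

Lemma triZ t : [/\ forall a x y z, t (a *: x) y z = a * t x y z,
  forall a x y z, t x (a *: y) z = a * t x y z &
  forall a x y z, t x y (a *: z) = a * t x y z].
Proof.
have [t1 t2 t3] := tri0 t; split=> a x y z.
- by rewrite -[a *: x]addr0 triP1 t1 addr0.
- by rewrite -[a *: y]addr0 triP2 t2 addr0.
- by rewrite -[a *: z]addr0 triP3 t3 addr0.
Qed.

Lemma free4P u1 u2 u3 u4 : reflect
  (forall a1 a2 a3 a4, lc4 u1 u2 u3 u4 a1 a2 a3 a4 = 0 -> [/\ a1 = 0, a2 = 0, a3 = 0 & a4 = 0])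
  (free [:: u1; u2; u3; u4]).
Proof.
apply: (iffP (@freeP _ _ _ [tuple u1; u2; u3; u4])) => [fr a1 a2 a3 a4|fr a].
  move=> v0; pose c (i : 'I_4) := [:: a1; a2; a3; a4]`_i.
  have c0 i : c i = 0.
    by apply: fr; rewrite !big_ord_recl big_ord0 addr0 -[RHS]v0.
  by split; [exact: (c0 0)|exact: (c0 1)|exact: (c0 2%:R)|exact: (c0 3%:R)].
rewrite !big_ord_recl big_ord0 addr0 => /fr[a1 a2 a3 a4] [[|[|[|[|//]]]] i].
- by rewrite -[RHS]a1; congr a; apply: val_inj.
- by rewrite -[RHS]a2; congr a; apply: val_inj.
- by rewrite -[RHS]a3; congr a; apply: val_inj.
- by rewrite -[RHS]a4; congr a; apply: val_inj.
Qed.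

Section Coordinates.

Variables (t : trilinear) (u1 u2 u3 u4 : V).
Let v := lc4 u1 u2 u3 u4.

Lemma tri_lc4 : [/\
  forall a1 a2 a3 a4 y z, t (v a1 a2 a3 a4) y z =
    a1 * t u1 y z + a2 * t u2 y z + a3 * t u3 y z + a4 * t u4 y z,
  forall a1 a2 a3 a4 x z, t x (v a1 a2 a3 a4) z =
    a1 * t x u1 z + a2 * t x u2 z + a3 * t x u3 z + a4 * t x u4 z &
  forall a1 a2 a3 a4 x y, t x y (v a1 a2 a3 a4) =
    a1 * t x y u1 + a2 * t x y u2 + a3 * t x y u3 + a4 * t x y u4].
Proof.
have [Z1 Z2 Z3] := triZ t.
by split=> *; rewrite /v /lc4 ?triP1 ?triP2 ?triP3 ?Z1 ?Z2 ?Z3 !addrA.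
Qed.

Lemma polar_lc4r w x1 x2 x3 x4 : polar t w (v x1 x2 x3 x4) =
  x1 * polar t w u1 + x2 * polar t w u2 + x3 * polar t w u3 + x4 * polar t w u4.
Proof. by have [T1 T2 T3] := tri_lc4; rewrite /polar T1 T2 T3; ring. Qed.

Lemma cub_lc4 x1 x2 x3 x4 : cub t (v x1 x2 x3 x4) =
  x1 ^+ 3 * cub t u1 + x2 ^+ 3 * cub t u2 + x3 ^+ 3 * cub t u3 + x4 ^+ 3 * cub t u4
  + x1 ^+ 2 * x2 * polar t u1 u2 + x1 ^+ 2 * x3 * polar t u1 u3
  + x1 ^+ 2 * x4 * polar t u1 u4 + x2 ^+ 2 * x1 * polar t u2 u1
  + x2 ^+ 2 * x3 * polar t u2 u3 + x2 ^+ 2 * x4 * polar t u2 u4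
  + x3 ^+ 2 * x1 * polar t u3 u1 + x3 ^+ 2 * x2 * polar t u3 u2
  + x3 ^+ 2 * x4 * polar t u3 u4 + x4 ^+ 2 * x1 * polar t u4 u1
  + x4 ^+ 2 * x2 * polar t u4 u2 + x4 ^+ 2 * x3 * polar t u4 u3
  + x1 * x2 * x3 * polar3 t u1 u2 u3 + x1 * x2 * x4 * polar3 t u1 u2 u4
  + x1 * x3 * x4 * polar3 t u1 u3 u4 + x2 * x3 * x4 * polar3 t u2 u3 u4.
Proof. by have [T1 T2 T3] := tri_lc4; rewrite /cub /polar /polar3 T1 !T2 !T3; ring. Qed.

Lemma polar_lc4 x1 x2 x3 x4 y1 y2 y3 y4 :
  polar t (v x1 x2 x3 x4) (v y1 y2 y3 y4) =
  3%:R * (x1 ^+ 2 * y1 * cub t u1 + x2 ^+ 2 * y2 * cub t u2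
        + x3 ^+ 2 * y3 * cub t u3 + x4 ^+ 2 * y4 * cub t u4)
  + (x1 ^+ 2 * y2 + 2%:R * x1 * x2 * y1) * polar t u1 u2
  + (x1 ^+ 2 * y3 + 2%:R * x1 * x3 * y1) * polar t u1 u3
  + (x1 ^+ 2 * y4 + 2%:R * x1 * x4 * y1) * polar t u1 u4
  + (x2 ^+ 2 * y1 + 2%:R * x2 * x1 * y2) * polar t u2 u1
  + (x2 ^+ 2 * y3 + 2%:R * x2 * x3 * y2) * polar t u2 u3
  + (x2 ^+ 2 * y4 + 2%:R * x2 * x4 * y2) * polar t u2 u4
  + (x3 ^+ 2 * y1 + 2%:R * x3 * x1 * y3) * polar t u3 u1
  + (x3 ^+ 2 * y2 + 2%:R * x3 * x2 * y3) * polar t u3 u2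
  + (x3 ^+ 2 * y4 + 2%:R * x3 * x4 * y3) * polar t u3 u4
  + (x4 ^+ 2 * y1 + 2%:R * x4 * x1 * y4) * polar t u4 u1
  + (x4 ^+ 2 * y2 + 2%:R * x4 * x2 * y4) * polar t u4 u2
  + (x4 ^+ 2 * y3 + 2%:R * x4 * x3 * y4) * polar t u4 u3
  + (x1 * x2 * y3 + x1 * y2 * x3 + y1 * x2 * x3) * polar3 t u1 u2 u3
  + (x1 * x2 * y4 + x1 * y2 * x4 + y1 * x2 * x4) * polar3 t u1 u2 u4
  + (x1 * x3 * y4 + x1 * y3 * x4 + y1 * x3 * x4) * polar3 t u1 u3 u4
  + (x2 * x3 * y4 + x2 * y3 * x4 + y2 * x3 * x4) * polar3 t u2 u3 u4.
Proof. by have [T1 T2 T3] := tri_lc4; rewrite /cub /polar /polar3 !(T1, T2, T3); ring. Qed.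

Lemma polar3_lc4 x1 x2 x3 x4 y1 y2 y3 y4 z1 z2 z3 z4 :
  polar3 t (v x1 x2 x3 x4) (v y1 y2 y3 y4) (v z1 z2 z3 z4) =
  6%:R * (x1 * y1 * z1 * cub t u1 + x2 * y2 * z2 * cub t u2
        + x3 * y3 * z3 * cub t u3 + x4 * y4 * z4 * cub t u4)
  + 2%:R * (
    (x1 * y1 * z2 + x1 * y2 * z1 + x2 * y1 * z1) * polar t u1 u2
  + (x1 * y1 * z3 + x1 * y3 * z1 + x3 * y1 * z1) * polar t u1 u3
  + (x1 * y1 * z4 + x1 * y4 * z1 + x4 * y1 * z1) * polar t u1 u4
  + (x2 * y2 * z1 + x2 * y1 * z2 + x1 * y2 * z2) * polar t u2 u1
  + (x2 * y2 * z3 + x2 * y3 * z2 + x3 * y2 * z2) * polar t u2 u3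
  + (x2 * y2 * z4 + x2 * y4 * z2 + x4 * y2 * z2) * polar t u2 u4
  + (x3 * y3 * z1 + x3 * y1 * z3 + x1 * y3 * z3) * polar t u3 u1
  + (x3 * y3 * z2 + x3 * y2 * z3 + x2 * y3 * z3) * polar t u3 u2
  + (x3 * y3 * z4 + x3 * y4 * z3 + x4 * y3 * z3) * polar t u3 u4
  + (x4 * y4 * z1 + x4 * y1 * z4 + x1 * y4 * z4) * polar t u4 u1
  + (x4 * y4 * z2 + x4 * y2 * z4 + x2 * y4 * z4) * polar t u4 u2
  + (x4 * y4 * z3 + x4 * y3 * z4 + x3 * y4 * z4) * polar t u4 u3)
  + (x1 * y2 * z3 + x1 * y3 * z2 + x2 * y1 * z3 + x2 * y3 * z1
     + x3 * y1 * z2 + x3 * y2 * z1) * polar3 t u1 u2 u3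
  + (x1 * y2 * z4 + x1 * y4 * z2 + x2 * y1 * z4 + x2 * y4 * z1
     + x4 * y1 * z2 + x4 * y2 * z1) * polar3 t u1 u2 u4
  + (x1 * y3 * z4 + x1 * y4 * z3 + x3 * y1 * z4 + x3 * y4 * z1
     + x4 * y1 * z3 + x4 * y3 * z1) * polar3 t u1 u3 u4
  + (x2 * y3 * z4 + x2 * y4 * z3 + x3 * y2 * z4 + x3 * y4 * z2
     + x4 * y2 * z3 + x4 * y3 * z2) * polar3 t u2 u3 u4.
Proof. by have [T1 T2 T3] := tri_lc4; rewrite /cub /polar /polar3 !(T1, T2, T3); ring. Qed.

Lemma lc4_basis : [/\ u1 = v 1 0 0 0, u2 = v 0 1 0 0, u3 = v 0 0 1 0 & u4 = v 0 0 0 1].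
Proof. by rewrite /v /lc4 !scale0r !scale1r !(addr0, add0r). Qed.

Lemma lc4_lin a b x1 x2 x3 x4 y1 y2 y3 y4 :
  a *: v x1 x2 x3 x4 + b *: v y1 y2 y3 y4 =
  v (a * x1 + b * y1) (a * x2 + b * y2) (a * x3 + b * y3) (a * x4 + b * y4).
Proof.
by rewrite /v /lc4 !scalerDr !scalerA !scalerDl addrACA; congr (_ + _);
   rewrite addrACA; congr (_ + _); rewrite addrACA.
Qed.

Lemma lc4_lc3 a b c x1 x2 x3 x4 y1 y2 y3 y4 z1 z2 z3 z4 :
  lc4 (v x1 x2 x3 x4) (v y1 y2 y3 y4) (v z1 z2 z3 z4) 0 a b c 0 =
  v (a * x1 + b * y1 + c * z1) (a * x2 + b * y2 + c * z2)
    (a * x3 + b * y3 + c * z3) (a * x4 + b * y4 + c * z4).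
Proof.
rewrite {1}/lc4 scaler0 addr0 lc4_lin.
by rewrite -[v (b * _ + _) _ _ _]scale1r lc4_lin !mul1r !addrA.
Qed.

Lemma lc4_lc4 a b c d x1 x2 x3 x4 y1 y2 y3 y4 z1 z2 z3 z4 r1 r2 r3 r4 :
  lc4 (v x1 x2 x3 x4) (v y1 y2 y3 y4) (v z1 z2 z3 z4) (v r1 r2 r3 r4) a b c d =
  v (a * x1 + b * y1 + c * z1 + d * r1) (a * x2 + b * y2 + c * z2 + d * r2)
    (a * x3 + b * y3 + c * z3 + d * r3) (a * x4 + b * y4 + c * z4 + d * r4).
Proof.
rewrite {1}/lc4 lc4_lin.
rewrite -[v (c * _ + _) _ _ _]scale1r lc4_lin !mul1r.
by rewrite -[v (b * _ + _) _ _ _]scale1r lc4_lin !mul1r !addrA.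
Qed.

Lemma lc4_swap12 x1 x2 x3 x4 : lc4 u2 u1 u3 u4 x1 x2 x3 x4 = v x2 x1 x3 x4.
Proof. by rewrite /v /lc4 addrCA. Qed.

Lemma free4_lc4 x1 x2 x3 x4 y1 y2 y3 y4 z1 z2 z3 z4 r1 r2 r3 r4 :
  free [:: u1; u2; u3; u4] ->
  (forall a b c d,
    a * x1 + b * y1 + c * z1 + d * r1 = 0 -> a * x2 + b * y2 + c * z2 + d * r2 = 0 ->
    a * x3 + b * y3 + c * z3 + d * r3 = 0 -> a * x4 + b * y4 + c * z4 + d * r4 = 0 ->
    [/\ a = 0, b = 0, c = 0 & d = 0]) ->
  free [:: v x1 x2 x3 x4; v y1 y2 y3 y4; v z1 z2 z3 z4; v r1 r2 r3 r4].
Proof.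
move=> /free4P fr H; apply/free4P => a b c d.
by rewrite lc4_lc4 => /fr[*]; apply: H.
Qed.

End Coordinates.

End CubicForms.

(** * Existence of a line *)

Section LineExistence.

Variables (k : closedFieldType) (V : vectType k).
Implicit Types (t : trilinear V) (u v w : V).

Definition smooth t := forall v, v != 0 -> cub t v = 0 -> exists w, polar t v w != 0.

(** These are the four coefficients of the cubic form restricted to the span of u and v. *)
Definition line t u v :=
  [/\ cub t u = 0, cub t v = 0, polar t u v = 0 & polar t v u = 0].

Lemma polyfun_ext (f g : k -> k) : f =1 g -> polyfun f -> polyfun g.
Proof. by move=> fg [p fE]; exists p => x; rewrite -fg fE. Qed.

Definition polyvec (x : k -> V) := exists u1 u2 u3 u4 f1 f2 f3 f4,
  [/\ polyfun f1, polyfun f2, polyfun f3, polyfun f4 &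
      forall a, x a = lc4 u1 u2 u3 u4 (f1 a) (f2 a) (f3 a) (f4 a)].

Lemma polyvec_lc4 u1 u2 u3 u4 f1 f2 f3 f4 :
  polyfun f1 -> polyfun f2 -> polyfun f3 -> polyfun f4 ->
  polyvec (fun a => lc4 u1 u2 u3 u4 (f1 a) (f2 a) (f3 a) (f4 a)).
Proof. by exists u1, u2, u3, u4, f1, f2, f3, f4. Qed.

Lemma polyvec_const u : polyvec (fun=> u).
Proof.
exists u, 0, 0, 0, (fun=> 1), (fun=> 0), (fun=> 0), (fun=> 0).
split; try exact: polyfun_const.
by move=> a; have [] := lc4_basis u 0 0 0.
Qed.

Lemma polyfun_tri t x y z : polyvec x -> polyvec y -> polyvec z ->
  polyfun (fun a => t (x a) (y a) (z a)).
Proof.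
have P1 y' z' x' : polyvec x' -> (forall v, polyfun (fun a => t v (y' a) (z' a))) ->
    polyfun (fun a => t (x' a) (y' a) (z' a)).
  move=> [u1 [u2 [u3 [u4 [f1 [f2 [f3 [f4 [? ? ? ? xE]]]]]]]]] Pv.
  apply: (@polyfun_ext (fun a => t (lc4 u1 u2 u3 u4 (f1 a) (f2 a) (f3 a) (f4 a)) (y' a) (z' a))).
    by move=> a; rewrite xE.
  have [T1 _ _] := tri_lc4 t u1 u2 u3 u4.
  apply: (polyfun_ext (fun a => esym (T1 _ _ _ _ _ _))).
  by do ![apply: polyfunD|apply: polyfunM].
have P2 v z' y' : polyvec y' -> (forall w, polyfun (fun a => t v w (z' a))) ->
    polyfun (fun a => t v (y' a) (z' a)).
  move=> [u1 [u2 [u3 [u4 [f1 [f2 [f3 [f4 [? ? ? ? xE]]]]]]]]] Pv.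
  apply: (@polyfun_ext (fun a => t v (lc4 u1 u2 u3 u4 (f1 a) (f2 a) (f3 a) (f4 a)) (z' a))).
    by move=> a; rewrite xE.
  have [_ T2 _] := tri_lc4 t u1 u2 u3 u4.
  apply: (polyfun_ext (fun a => esym (T2 _ _ _ _ _ _))).
  by do ![apply: polyfunD|apply: polyfunM].
have P3 v w z' : polyvec z' -> polyfun (fun a => t v w (z' a)).
  move=> [u1 [u2 [u3 [u4 [f1 [f2 [f3 [f4 [? ? ? ? xE]]]]]]]]].
  apply: (@polyfun_ext (fun a => t v w (lc4 u1 u2 u3 u4 (f1 a) (f2 a) (f3 a) (f4 a)))).
    by move=> a; rewrite xE.
  have [_ _ T3] := tri_lc4 t u1 u2 u3 u4.
  apply: (polyfun_ext (fun a => esym (T3 _ _ _ _ _ _))).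
  by do ![apply: polyfunD|apply: polyfunM|exact: polyfun_const].
by move=> Px Py Pz; apply: P1 => // v; apply: P2 => // w; apply: P3.
Qed.

Lemma polyfun_cub t x : polyvec x -> polyfun (fun a => cub t (x a)).
Proof. by move=> Px; apply: polyfun_tri. Qed.

Lemma polyfun_polar t x y : polyvec x -> polyvec y ->
  polyfun (fun a => polar t (x a) (y a)).
Proof. by move=> Px Py; do ![apply: polyfunD|apply: polyfun_tri]. Qed.

Lemma polyfun_polar3 t x y z : polyvec x -> polyvec y -> polyvec z ->
  polyfun (fun a => polar3 t (x a) (y a) (z a)).
Proof. by move=> Px Py Pz; do ![apply: polyfunD|apply: polyfun_tri]. Qed.

Lemma polyfun_res23 (b0 b1 b2 c0 c1 c2 c3 : k -> k) :
  polyfun b0 -> polyfun b1 -> polyfun b2 ->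
  polyfun c0 -> polyfun c1 -> polyfun c2 -> polyfun c3 ->
  polyfun (fun a => res23 (b0 a) (b1 a) (b2 a) (c0 a) (c1 a) (c2 a) (c3 a)).
Proof.
by move=> *; rewrite /res23; polyfun_tac.
Qed.

(* If cub t p = 0 and polar t p vanishes on q1 and q2, then cub t (p + x q1 + y q2)
   is the sum of a quadratic and a cubic form in x, y; their common zeros are the
   directions of the lines of the surface through p in the plane p, q1, q2. *)
Definition line_res t p q1 q2 :=
  res23 (polar t q1 p) (polar3 t q1 q2 p) (polar t q2 p)
        (cub t q1) (polar t q1 q2) (polar t q2 q1) (cub t q2).

Lemma polyfun_line_res t p q1 q2 : polyvec p -> polyvec q1 -> polyvec q2 ->
  polyfun (fun a => line_res t (p a) (q1 a) (q2 a)).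
Proof.
by move=> *; apply: polyfun_res23; do ![apply: polyfun_cub|apply: polyfun_polar
  |apply: polyfun_polar3|assumption].
Qed.

(** Adding multiples of p to the directions changes the cubic form by a multiple of the quadratic
    one, which the resultant ignores. The triangular change of q1, q2 has determinant b c, which
    enters to the power 2 * 3, and scaling p scales the quadratic form. *)
Lemma line_res_frame t p q1 q2 (a b c d e f : k) :
  cub t p = 0 -> polar t p q1 = 0 -> polar t p q2 = 0 ->
  line_res t (lc4 q1 q2 p 0 0 0 a 0) (lc4 q1 q2 p 0 b 0 d 0) (lc4 q1 q2 p 0 e c f 0) =
  a ^+ 3 * (b * c) ^+ 6 * line_res t p q1 q2.
Proof.
move=> Fp p1 p2; rewrite /line_res !(cub_lc4, polar_lc4, polar3_lc4) Fp p1 p2.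
by rewrite /res23; ring.
Qed.

Lemma line_of_res t p q1 q2 :
  cub t p = 0 -> polar t p q1 = 0 -> polar t p q2 = 0 ->
  (forall a b c, lc4 q1 q2 p 0 a b c 0 = 0 -> [/\ a = 0, b = 0 & c = 0]) ->
  line_res t p q1 q2 = 0 -> exists u v, free [:: u; v] /\ line t u v.
Proof.
move=> Fp p1 p2 ind /res23_common_zero[x [y [xy0 Bxy Cxy]]].
have [_ _ pE _] := lc4_basis q1 q2 p 0.
exists p, (lc4 q1 q2 p 0 x y 0 0); split.
  apply/(@freeP _ _ _ [tuple _; _]) => c.
  rewrite !big_ord_recl big_ord0 /= addr0 {1}pE lc4_lin !(mulr0, mulr1, addr0, add0r).
  set c1 := c (lift _ _) => /ind[cx cy c0].
  have c10 : c1 = 0.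
    apply/eqP; move/eqP: cx; move/eqP: cy; rewrite !mulf_eq0.
    by case: (c1 == 0) => //= /eqP y0 /eqP x0; move: xy0; rewrite x0 y0 eqxx.
  move=> [[|[|//]] i]; first by rewrite -[RHS]c0; congr c; apply: val_inj.
  by rewrite -[RHS]c10; congr c; apply: val_inj.
split=> //.
- by rewrite cub_lc4 Fp p1 p2 -[RHS]Cxy; ring.
- have -> : polar t p = polar t (lc4 q1 q2 p 0 0 0 1 0) by rewrite -pE.
  by rewrite polar_lc4 Fp p1 p2; ring.
- set v := lc4 _ _ _ _ x y 0 0.
  have -> : polar t v p = polar t v (lc4 q1 q2 p 0 0 0 1 0) by rewrite -pE.
  by rewrite polar_lc4 Fp p1 p2 -[RHS]Bxy; ring.
Qed.

End LineExistence.

(** * A line from a nodal tangent section *)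

Section NodalSection.

Variables (k : closedFieldType) (V : vectType k) (t : trilinear V).

(* The nodal cubic x y z = c1 x^3 + c2 y^3 in the plane e1, e2, e3 has its node e3
   at the parameters a = 0 and a = oo.  The two directions span the tangent plane
   modulo the point even at a = 0; exchanging e1 and e2 gives the frame at oo. *)
Definition node_pt (e1 e2 e3 e4 : V) (c1 c2 a : k) :=
  lc4 e1 e2 e3 e4 a (a ^+ 2) (c1 + c2 * a ^+ 3) 0.
Definition node_dir1 (e1 e2 e3 e4 : V) (c1 c2 a : k) :=
  lc4 e1 e2 e3 e4 1 (2%:R * a) (3%:R * c2 * a ^+ 2) 0.
(** At the point, [polar] takes the value c1 a on e2 + 2 c2 a e3, so subtracting g times this vector
    makes c1 a e4 tangent. A correction by e3 alone would give a multiple of the point at a = 0. *)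
Definition node_dir2 (e1 e2 e3 e4 : V) (c1 c2 a : k) :=
  let g := polar t (node_pt e1 e2 e3 e4 c1 c2 a) e4 in
  lc4 e1 e2 e3 e4 0 (- g) (- 2%:R * c2 * a * g) (c1 * a).
Definition node_res (e1 e2 e3 e4 : V) (c1 c2 a : k) :=
  line_res t (node_pt e1 e2 e3 e4 c1 c2 a) (node_dir1 e1 e2 e3 e4 c1 c2 a)
    (node_dir2 e1 e2 e3 e4 c1 c2 a).

Lemma polyfun_node_res e1 e2 e3 e4 c1 c2 : polyfun (node_res e1 e2 e3 e4 c1 c2).
Proof.
have Pp : polyvec (node_pt e1 e2 e3 e4 c1 c2).
  by apply: polyvec_lc4; polyfun_tac.
have Pg : polyfun (fun a => polar t (node_pt e1 e2 e3 e4 c1 c2 a) e4).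
  by apply: polyfun_polar => //; apply: polyvec_const.
by apply: polyfun_line_res => //; apply: polyvec_lc4; polyfun_tac.
Qed.

(** On the plane e1, e2, e3 the form is x y z - c1 x^3 - c2 y^3; the condition on e4 is smoothness
    of the surface at the node e3. *)
Definition nodal_frame (e1 e2 e3 e4 : V) (c1 c2 : k) :=
  [/\ [/\ cub t e1 = - c1, cub t e2 = - c2 & cub t e3 = 0],
      [/\ polar t e1 e2 = 0, polar t e2 e1 = 0, polar t e1 e3 = 0 & polar t e2 e3 = 0],
      [/\ polar t e3 e1 = 0, polar t e3 e2 = 0 & polar t e3 e4 != 0],
      polar3 t e1 e2 e3 = 1 &
      [/\ c1 != 0, c2 != 0 & free [:: e1; e2; e3; e4]]].

Lemma nodal_frame_swap e1 e2 e3 e4 c1 c2 :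
  nodal_frame e1 e2 e3 e4 c1 c2 -> nodal_frame e2 e1 e3 e4 c2 c1.
Proof.
move=> [[? ? ?] [? ? ? ?] [? ? ?] E [? ? fr]]; split=> //.
  by rewrite -E /polar3; ring.
by split=> //; rewrite (perm_free (Y := [:: e1; e2; e3; e4])) // (perm_catCA [:: e2] [:: e1]).
Qed.

(** At the node the quadratic form is a multiple of x y, while the cubic form has nonzero
    coefficients at x^3 and y^3: they have no common zero. *)
Lemma node_res0_neq0 e1 e2 e3 e4 c1 c2 : nodal_frame e1 e2 e3 e4 c1 c2 ->
  node_res e1 e2 e3 e4 c1 c2 0 != 0.
Proof.
move=> [[F1 F2 F3] [D12 D21 D13 D23] [D31 D32 D34] E [c10 c20 fr]].
set g := polar t e3 e4 in D34.
have -> : node_res e1 e2 e3 e4 c1 c2 0 = - (c1 ^+ 16 * c2 * g ^+ 6).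
  have gE : polar t (node_pt e1 e2 e3 e4 c1 c2 0) e4 = c1 ^+ 2 * g.
    have [_ _ _ e4E] := lc4_basis e1 e2 e3 e4; rewrite {2}e4E polar_lc4.
    by rewrite F1 F2 F3 D12 D21 D13 D23 D31 D32 E -/g; ring.
  rewrite /node_res /line_res /node_dir2 gE /node_dir1 /node_pt /=.
  rewrite !(cub_lc4, polar_lc4, polar3_lc4).
  by rewrite F1 F2 F3 D12 D21 D13 D23 D31 D32 E -/g /res23; ring.
by rewrite oppr_eq0 !mulf_neq0 ?expf_neq0.
Qed.

(** Exchanging e1 and e2 replaces the parameter a by b = 1/a. By [line_res_frame] the two resultants
    differ by the factor (b^3)^3 (b^3 c2/c1)^6, which gives the degree 27, and the exchanged one is
    nonzero at b = 0. *)
Lemma nodal_line e1 e2 e3 e4 c1 c2 : nodal_frame e1 e2 e3 e4 c1 c2 ->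
  exists u v, free [:: u; v] /\ line t u v.
Proof.
move=> fr; have fr' := nodal_frame_swap fr.
have := node_res0_neq0 fr'.
case: fr => [[F1 F2 F3] [D12 D21 D13 D23] [D31 D32 D34] E [c10 c20 fr]].
have [e1E e2E e3E e4E] := lc4_basis e1 e2 e3 e4.
pose P := node_pt e1 e2 e3 e4 c1 c2; pose Q1 := node_dir1 e1 e2 e3 e4 c1 c2.
pose Q2 := node_dir2 e1 e2 e3 e4 c1 c2.
have FP a : cub t (P a) = 0.
  by rewrite cub_lc4 F1 F2 F3 D12 D21 D13 D23 D31 D32 E; ring.
have DP1 a : polar t (P a) (Q1 a) = 0.
  by rewrite polar_lc4 F1 F2 F3 D12 D21 D13 D23 D31 D32 E; ring.
have DP2 a : polar t (P a) (Q2 a) = 0.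
  rewrite polar_lc4r -/(P a).
  have -> : polar t (P a) e2 = c1 * a - 2%:R * c2 * a ^+ 4.
    by rewrite e2E polar_lc4 F1 F2 F3 D12 D21 D13 D23 D31 D32 E; ring.
  have -> : polar t (P a) e3 = a ^+ 3.
    by rewrite e3E polar_lc4 F1 F2 F3 D12 D21 D13 D23 D31 D32 E; ring.
  by ring.
move=> /(root_of_reciprocal (f := node_res e1 e2 e3 e4 c1 c2)
   (kappa := (c2 / c1) ^+ 6) (n := 27)) [] //; try exact: polyfun_node_res.
  move=> b b0; set a := b^-1.
  pose g := polar t (P a) e4.
  (* Coordinates of the exchanged second direction at b in the frame [Q1 a], [Q2 a], [P a]. *)
  pose A := b ^+ 2 * c2 / c1; pose e := A * b * g + b ^+ 6 * g.
  pose f := - b * (2%:R * b ^+ 6 * g + A * b * g).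
  have PE : node_pt e2 e1 e3 e4 c2 c1 b = lc4 (Q1 a) (Q2 a) (P a) 0 0 0 (b ^+ 3) 0.
    by rewrite lc4_lc3 /node_pt lc4_swap12 /a; congr lc4; field.
  have gE : polar t (node_pt e2 e1 e3 e4 c2 c1 b) e4 = b ^+ 6 * g.
    rewrite /g /node_pt lc4_swap12 {2}e4E [in RHS]e4E !polar_lc4 /a.
    by rewrite F1 F2 F3 D12 D21 D13 D23 D31 D32 E; field.
  have Q1E : node_dir1 e2 e1 e3 e4 c2 c1 b = lc4 (Q1 a) (Q2 a) (P a) 0 (- b) 0 (3%:R * b ^+ 2) 0.
    by rewrite lc4_lc3 /node_dir1 lc4_swap12 /a; congr lc4; field.
  have Q2E : node_dir2 e2 e1 e3 e4 c2 c1 b = lc4 (Q1 a) (Q2 a) (P a) 0 e A f 0.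
    rewrite lc4_lc3 /node_dir2 gE lc4_swap12 -/(P a) -/g /e /f /A /a.
    by congr lc4; field; rewrite ?b0 ?c10.
  rewrite {1}/node_res PE Q1E Q2E line_res_frame //.
  by rewrite /node_res /A; field; rewrite ?b0 ?c10.
move=> a res0; apply: (line_of_res (FP a) (DP1 a) (DP2 a)) => // x y z.
rewrite lc4_lc3 => /(free4P _ _ _ _ fr)[].
set g := polar _ _ _ => h1 h2 h3 h4.
(* Independence of the frame: at a = 0 it consists of nonzero multiples of e1, e2, e3; elsewhere the
   e4-coordinate c1 a isolates y. *)
case: (eqVneq a 0) => [a0|a0].
  have x0 : x = 0 by rewrite -[RHS]h1 a0; ring.
  have y0 : y = 0.
    have : y * (c1 ^+ 2 * polar t e3 e4) = 0.
      rewrite -[RHS]oppr0 -h2 a0 /g /node_pt {3}e4E polar_lc4 a0.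
      by rewrite F1 F2 F3 D12 D21 D13 D23 D31 D32 E x0; ring.
    by move/eqP; rewrite !mulf_eq0 (negPf c10) (negPf D34) !orbF => /eqP.
  split=> //; have : z * c1 = 0 by rewrite -[RHS]h3 x0 y0 a0; ring.
  by move/eqP; rewrite mulf_eq0 (negPf c10) orbF => /eqP.
have y0 : y = 0.
  have : y * (c1 * a) = 0 by rewrite -[RHS]h4; ring.
  by move/eqP; rewrite !mulf_eq0 (negPf c10) (negPf a0) !orbF => /eqP.
have z0 : z = 0.
  have : z * (a * a) = 0.
    by apply: (eq_lincomb (m := -1) h2); apply: (eq_lincomb (m := 2%:R * a) h1); rewrite y0; ring.
  by move/eqP; rewrite !mulf_eq0 (negPf a0) !orbF => /eqP.
by split=> //; rewrite -[RHS]h1 y0 z0; ring.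
Qed.


End NodalSection.

(** * A line from a cuspidal tangent section *)

Section CuspidalSection.

Variables (k : closedFieldType) (V : vectType k) (t : trilinear V).

(* The plane section is x^2 z = c1 x y^2 + c2 y^3.  Its cusp is the point a = oo
   of the parametrization, so that it suffices to see that [line_res] is a
   polynomial in a of exact degree 27. *)
Lemma cuspidal_line e1 e2 e3 e4 (c1 c2 : k) :
  [/\ cub t e1 = 0, cub t e2 = - c2 & cub t e3 = 0] ->
  [/\ polar t e1 e2 = 0, polar t e2 e1 = - c1, polar t e1 e3 = 1 & polar t e2 e3 = 0] ->
  [/\ polar t e3 e1 = 0, polar t e3 e2 = 0 & polar t e3 e4 != 0] ->
  polar3 t e1 e2 e3 = 0 -> c2 != 0 -> free [:: e1; e2; e3; e4] ->
  exists u v, free [:: u; v] /\ line t u v.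
Proof.
move=> [F1 F2 F3] [D12 D21 D13 D23] [D31 D32 D34] E c20 fr.
have [e1E e2E e3E e4E] := lc4_basis e1 e2 e3 e4.
pose v := lc4 e1 e2 e3 e4.
have H1 x y z : polar t (v x y z 0) e4 = x ^+ 2 * polar t e1 e4 + y ^+ 2 * polar t e2 e4
    + z ^+ 2 * polar t e3 e4 + x * y * polar3 t e1 e2 e4 + x * z * polar3 t e1 e3 e4
    + y * z * polar3 t e2 e3 e4.
  by rewrite {1}e4E polar_lc4; ring.
have H2 x y z : polar t e4 (v x y z 0) = x * polar t e4 e1 + y * polar t e4 e2 + z * polar t e4 e3.
  by rewrite polar_lc4r; ring.
have H3 x y z x' y' z' : polar3 t (v x y z 0) e4 (v x' y' z' 0) =
    2%:R * (x * x' * polar t e1 e4 + y * y' * polar t e2 e4 + z * z' * polar t e3 e4)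
    + (x * y' + y * x') * polar3 t e1 e2 e4 + (x * z' + z * x') * polar3 t e1 e3 e4
    + (y * z' + z * y') * polar3 t e2 e3 e4.
  by rewrite {1}e4E polar3_lc4; ring.
have H4 x y z : polar3 t e3 e4 (v x y z 0) =
    x * polar3 t e1 e3 e4 + y * polar3 t e2 e3 e4 + 2%:R * z * polar t e3 e4.
  have -> : polar3 t e3 e4 = polar3 t (v 0 0 1 0) (v 0 0 0 1) by rewrite /v -e3E -e4E.
  by rewrite polar3_lc4; ring.
pose P a := v 1 a (c1 * a ^+ 2 + c2 * a ^+ 3) 0.
pose Q1 a := v 0 1 (2%:R * c1 * a + 3%:R * c2 * a ^+ 2) 0.
pose Q2 a := v 0 0 (- polar t (P a) e4) 1.
have FP a : cub t (P a) = 0.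
  by rewrite cub_lc4 F1 F2 F3 D12 D21 D13 D23 D31 D32 E; ring.
have DP1 a : polar t (P a) (Q1 a) = 0.
  by rewrite polar_lc4 F1 F2 F3 D12 D21 D13 D23 D31 D32 E; ring.
have DP2 a : polar t (P a) (Q2 a) = 0.
  rewrite polar_lc4r.
  have -> : polar t (P a) e3 = 1.
    by rewrite e3E polar_lc4 F1 F2 F3 D12 D21 D13 D23 D31 D32 E; ring.
  by ring.
(* Reversed parametrizations: for b = 1/a, [P a] is a^3 [P' b] and [Q1 a] is a^2 [Q' b]. *)
pose P' b := v (b ^+ 3) (b ^+ 2) (c1 * b + c2) 0.
pose Q' b := v 0 (b ^+ 2) (2%:R * c1 * b + 3%:R * c2) 0.
pose g b := polar t (P' b) e4.
(* The i-th coefficient of the quadratic form is a^(1 + 4 i) times the one listed here, that of the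
   cubic form a^(4 i) times; the resultant thus acquires a^27. *)
pose res b := res23 (- c1 * b - 3%:R * c2) (polar3 t (Q' b) e4 (P' b))
   (b ^+ 6 * polar t e4 (P' b) - g b * polar3 t e3 e4 (P' b))
   (- c2) (polar t (Q' b) e4) (b ^+ 6 * polar t e4 (Q' b) - g b * polar3 t e3 e4 (Q' b))
   (b ^+ 12 * cub t e4 - b ^+ 6 * g b * polar t e4 e3 + g b ^+ 2 * polar t e3 e4).
have Ppol : polyvec P.
  by apply: polyvec_lc4; polyfun_tac.
have P'pol : polyvec P'.
  by apply: polyvec_lc4; polyfun_tac.
have Q1pol : polyvec Q1.
  by apply: polyvec_lc4; polyfun_tac.
have Q'pol : polyvec Q'.
  by apply: polyvec_lc4; polyfun_tac.
have Q2pol : polyvec Q2.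
  apply: polyvec_lc4; do ?[exact: polyfun_const]; apply: polyfunN.
  by apply: polyfun_polar => //; apply: polyvec_const.
have gpol : polyfun g by apply: polyfun_polar => //; apply: polyvec_const.
have respol : polyfun res.
  by apply: polyfun_res23; do ![exact: gpol|exact: polyfun_const|exact: polyfun_id
    |apply: polyfun_polar3|apply: polyfun_polar|exact: polyvec_const|done
    |apply: polyfunN|apply: polyfunD|apply: polyfunM|apply: polyfunX].
have Fpol : polyfun (fun a => line_res t (P a) (Q1 a) (Q2 a)) by apply: polyfun_line_res.
have [|b b0||a res0] := root_of_reciprocal (kappa := 1) (n := 27) Fpol respol.
- by [].
- pose a := b^-1.
  have gE : polar t (P a) e4 = a ^+ 6 * g b.
    by rewrite /g !H1 /a; field.
  rewrite /line_res.
  have -> : polar t (Q1 a) (P a) = a * (- c1 * b - 3%:R * c2).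
    by rewrite polar_lc4 F1 F2 F3 D12 D21 D13 D23 D31 D32 E /a; field.
  have -> : polar3 t (Q1 a) (Q2 a) (P a) = a ^+ 5 * polar3 t (Q' b) e4 (P' b).
    by rewrite H3 polar3_lc4 gE F1 F2 F3 D12 D21 D13 D23 D31 D32 E /a; field.
  have -> : polar t (Q2 a) (P a) = a ^+ 9 *
      (b ^+ 6 * polar t e4 (P' b) - g b * polar3 t e3 e4 (P' b)).
    by rewrite H2 H4 polar_lc4 gE F1 F2 F3 D12 D21 D13 D23 D31 D32 E /a; field.
  have -> : cub t (Q1 a) = - c2.
    by rewrite cub_lc4 F1 F2 F3 D12 D21 D13 D23 D31 D32 E; ring.
  have -> : polar t (Q1 a) (Q2 a) = a ^+ 4 * polar t (Q' b) e4.
    by rewrite H1 polar_lc4 gE F1 F2 F3 D12 D21 D13 D23 D31 D32 E /a; field.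
  have -> : polar t (Q2 a) (Q1 a) = a ^+ 8 *
      (b ^+ 6 * polar t e4 (Q' b) - g b * polar3 t e3 e4 (Q' b)).
    by rewrite H2 H4 polar_lc4 gE F1 F2 F3 D12 D21 D13 D23 D31 D32 E /a; field.
  have -> : cub t (Q2 a) = a ^+ 12 * (b ^+ 12 * cub t e4
      - b ^+ 6 * g b * polar t e4 e3 + g b ^+ 2 * polar t e3 e4).
    by rewrite cub_lc4 gE F3 /a; field.
  by rewrite /res /res23 /a; field.
- have -> : res 0 = c2 ^+ 11 * polar t e3 e4 ^+ 6.
    by rewrite /res /g !H1 !H2 !H3 !H4 /res23; ring.
  by rewrite mulf_neq0 ?expf_neq0.
apply: (line_of_res (FP a) (DP1 a) (DP2 a)) => // x y z.
rewrite lc4_lc3 => /(free4P _ _ _ _ fr)[h1 h2 h3 h4].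
have z0 : z = 0 by rewrite -[RHS]h1; ring.
have y0 : y = 0 by rewrite -[RHS]h4; ring.
by split=> //; rewrite -[RHS]h2 z0 y0; ring.
Qed.

End CuspidalSection.

(** * A line on every smooth cubic surface *)

Section Line.

Variables (k : closedFieldType) (V : vectType k) (t : trilinear V).
Hypothesis dimV : \dim {:V} = 4.
Implicit Types (u v w p q r e : V).

Lemma free_extend (X : seq V) : free X -> (size X < 4)%N -> exists v, free (v :: X).
Proof.
move=> frX sX; have /subvPn[v _ vX] : ~~ ({:V} <= <<X>>)%VS.
  by apply/negP => /dimvS; rewrite dimV (eqnP frX) leqNgt sX.
by exists v; rewrite free_cons vX.
Qed.

Lemma free4_span e1 e2 e3 e4 : free [:: e1; e2; e3; e4] ->
  forall v, exists a1 a2 a3 a4, v = lc4 e1 e2 e3 e4 a1 a2 a3 a4.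
Proof.
move=> fr v.
have vin : v \in <<[tuple e1; e2; e3; e4]>>%VS.
  have -> : (<<[tuple e1; e2; e3; e4]>> = fullv)%VS; last exact: memvf.
  by apply/eqP; rewrite eqEdim subvf (eqnP fr) dimV.
have := coord_span vin; rewrite !big_ord_recl big_ord0 addr0 => vE.
by rewrite vE; do 4!eexists.
Qed.

Lemma free_extend2 u v : free [:: u; v] -> exists w r, free [:: u; v; w; r].
Proof.
move=> fr; have [w frw] := free_extend fr isT; have [r frr] := free_extend frw isT.
exists w, r; rewrite (perm_free (Y := [:: r; w; u; v])) //.
by apply/permP => P /=; ring.
Qed.

(** The form in which smoothness is used: a differential vanishing on three basis vectors cannot
    vanish on the fourth. *)
Lemma smooth_direction e1 e2 e3 e4 : smooth t -> free [:: e1; e2; e3; e4] ->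
  forall v, v != 0 -> cub t v = 0 -> polar t v e1 = 0 -> polar t v e2 = 0 ->
  polar t v e3 = 0 -> polar t v e4 != 0.
Proof.
move=> sm fr v v0 Fv D1 D2 D3; have [w] := sm v v0 Fv.
have [a1 [a2 [a3 [a4 ->]]]] := free4_span fr w; rewrite polar_lc4r D1 D2 D3 !mulr0 !add0r.
by rewrite mulf_eq0 negb_or => /andP[].
Qed.

Lemma point_exists : exists2 v, v != 0 & cub t v = 0.
Proof.
have [u fru] := free_extend (nil_free V) isT; have [v fruv] := free_extend fru isT.
have [w [r fr]] := free_extend2 fruv.
have [x [y [xy0 Fxy]]] := binary_cubic_zero (cub t v) (polar t v u) (polar t u v) (cub t u).
exists (lc4 v u w r x y 0 0); last by rewrite cub_lc4 -[RHS]Fxy; ring.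
by apply: contraL xy0 => /eqP /(free4P _ _ _ _ fr)[-> -> _ _]; rewrite eqxx.
Qed.

Lemma tangent_frame (p : V) : smooth t -> p != 0 -> cub t p = 0 ->
  exists e1 e2 e4, [/\ free [:: e1; e2; p; e4], polar t p e1 = 0,
    polar t p e2 = 0 & polar t p e4 != 0].
Proof.
move=> sm p0 Fp.
have polar_pp : polar t p p = 0 by rewrite polar_self Fp mulr0.
have claim u1 u2 u3 : free [:: u1; u2; p; u3] -> polar t p u3 != 0 ->
    exists e1 e2 e4, [/\ free [:: e1; e2; p; e4], polar t p e1 = 0,
      polar t p e2 = 0 & polar t p e4 != 0].
  move=> fr D3; pose d i := polar t p i / polar t p u3.
  exists (lc4 u1 u2 p u3 1 0 0 (- d u1)), (lc4 u1 u2 p u3 0 1 0 (- d u2)), u3.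
  split=> //; last 2 first.
  - by rewrite polar_lc4r polar_pp /d; field.
  - by rewrite polar_lc4r polar_pp /d; field.
  have [_ _ pE u3E] := lc4_basis u1 u2 p u3.
  have pu3E x y : [:: x; y; p; u3] = [:: x; y; lc4 u1 u2 p u3 0 0 1 0; lc4 u1 u2 p u3 0 0 0 1].
    by rewrite -pE -u3E.
  rewrite pu3E; apply: free4_lc4 => // a1 a2 a3 a4; rewrite !(mulr0, mulr1, addr0, add0r).
  by move=> -> -> ->; rewrite !mul0r !add0r => ->.
have [u1 fr1] : exists u1, free [:: u1; p].
  by apply: free_extend => //; rewrite seq1_free.
have [u2 [u3 fr]] := free_extend2 fr1.
case: (eqVneq (polar t p u3) 0) => [D3|]; last first.
  apply: (claim u1 u2); rewrite (perm_free (Y := [:: u1; p; u2; u3])) //.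
  by apply/permP => P /=; ring.
case: (eqVneq (polar t p u2) 0) => [D2|]; last first.
  apply: (claim u1 u3); rewrite (perm_free (Y := [:: u1; p; u2; u3])) //.
  by apply/permP => P /=; ring.
have fr' : free [:: u3; u2; p; u1].
  by rewrite (perm_free (Y := [:: u1; p; u2; u3])) //; apply/permP => P /=; ring.
exact: claim fr' (smooth_direction sm fr' p0 Fp D3 D2 polar_pp).
Qed.

Lemma free13 e1 e2 e3 e4 : free [:: e1; e2; e3; e4] -> free [:: e1; e3].
Proof.
rewrite (perm_free (Y := [:: e1; e3] ++ [:: e2; e4])); first exact: catl_free.
by apply/permP => P /=; ring.
Qed.

Lemma free_swap12 e1 e2 e3 e4 : free [:: e1; e2; e3; e4] -> free [:: e2; e1; e3; e4].
Proof.
by rewrite (perm_free (Y := [:: e2; e1; e3; e4])) //; apply/permP => P /=; ring.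
Qed.

Section TangentSection.

Variables (e1 e2 p e4 : V).
Hypotheses (fr : free [:: e1; e2; p; e4]) (Fp : cub t p = 0)
  (Dp1 : polar t p e1 = 0) (Dp2 : polar t p e2 = 0) (Dp4 : polar t p e4 != 0).

(** Subtracting multiples of p from e1 and e2 removes the terms x^2 y and x y^2. If x^3 or y^3 is
    missing, e1 or e2 spans a line with p. *)
Lemma line_of_node : polar t e1 p = 0 -> polar t e2 p = 0 -> polar3 t e1 e2 p = 1 ->
  exists u v, free [:: u; v] /\ line t u v.
Proof.
move=> D1p D2p E.
case: (eqVneq (cub t e1) 0) => [F1|F1]; first by exists e1, p; split=> //; apply: free13 fr.
case: (eqVneq (cub t e2) 0) => [F2|F2].
  by exists e2, p; split=> //; apply: free13 (free_swap12 fr).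
have [_ _ pE e4E] := lc4_basis e1 e2 p e4.
apply: (@nodal_line _ _ t (lc4 e1 e2 p e4 1 0 (- polar t e1 e2) 0)
  (lc4 e1 e2 p e4 0 1 (- polar t e2 e1) 0)
  (lc4 e1 e2 p e4 0 0 1 0) (lc4 e1 e2 p e4 0 0 0 1) (- cub t e1) (- cub t e2)).
split; rewrite ?(cub_lc4, polar_lc4, polar3_lc4) ?Fp ?Dp1 ?Dp2 ?D1p ?D2p ?E.
- by split; ring.
- by split; ring.
- split; [ring|ring|].
  set x := (X in X != 0); have -> : x = polar t p e4 by rewrite /x; ring.
  by [].
- ring.
split; rewrite ?oppr_eq0 //.
apply: free4_lc4 => // a b c d.
by rewrite !(mulr0, mulr1, addr0, add0r) => -> ->; rewrite !mul0r !add0r.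
Qed.

(** With quadratic part x^2 at p, subtracting multiples of p from e1 and e2 removes the terms x^3
    and x^2 y. If y^3 is missing, e2 and p span a line. *)
Lemma line_of_cusp : polar t e1 p = 1 -> polar t e2 p = 0 -> polar3 t e1 e2 p = 0 ->
  exists u v, free [:: u; v] /\ line t u v.
Proof.
move=> D1p D2p E.
case: (eqVneq (cub t e2) 0) => [F2|F2].
  by exists e2, p; split=> //; apply: free13 (free_swap12 fr).
apply: (@cuspidal_line _ _ t (lc4 e1 e2 p e4 1 0 (- cub t e1) 0)
  (lc4 e1 e2 p e4 0 1 (- polar t e1 e2) 0)
  (lc4 e1 e2 p e4 0 0 1 0) (lc4 e1 e2 p e4 0 0 0 1) (- polar t e2 e1) (- cub t e2));
  rewrite ?(cub_lc4, polar_lc4, polar3_lc4) ?Fp ?Dp1 ?Dp2 ?D1p ?D2p ?E ?oppr_eq0 //.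
- by split; ring.
- by split; ring.
- split; [ring|ring|].
  set x := (X in X != 0); have -> : x = polar t p e4 by rewrite /x; ring.
  by [].
- ring.
apply: free4_lc4 => // a b c d.
by rewrite !(mulr0, mulr1, addr0, add0r) => -> ->; rewrite !mul0r !add0r.
Qed.

End TangentSection.

(** In the tangent plane the form is z B(x, y) + C(x, y), with p at x = y = 0. Independent factors
    of B lead to a node, proportional nonzero ones to a cusp; for B = 0 a zero of C is the direction
    of a line through p. *)
Lemma line_exists : smooth t -> exists u v, free [:: u; v] /\ line t u v.
Proof.
move=> sm; have [p p0 Fp] := point_exists.
have [e1 [e2 [e4 [fr D1 D2 D4]]]] := tangent_frame sm p0 Fp.
have [r0 [r1 [q0 [q1 [B11 B12 B22]]]]] :=
  binary_quadratic_factor (polar t e1 p) (polar3 t e1 e2 p) (polar t e2 p).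
have [e1E e2E pE e4E] := lc4_basis e1 e2 p e4.
pose v := lc4 e1 e2 p e4.
have frv a b c d : a * d - b * c != 0 ->
    free [:: v a b 0 0; v c d 0 0; p; e4].
  move=> det; have -> : [:: v a b 0 0; v c d 0 0; p; e4] =
    [:: v a b 0 0; v c d 0 0; v 0 0 1 0; v 0 0 0 1] by rewrite /v -pE -e4E.
  apply: free4_lc4 => // x y z w.
  rewrite !(mulr0, mulr1, addr0, add0r) => h1 h2.
  have -> : x = 0.
    apply: (mulIf det); apply: (eq_lincomb (m := d) h1).
    by apply: (eq_lincomb (m := - c) h2); ring.
  have -> : y = 0.
    apply: (mulIf det); apply: (eq_lincomb (m := - b) h1).
    by apply: (eq_lincomb (m := a) h2); ring.
  by [].
have Dpv a b : polar t p (v a b 0 0) = 0.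
  by rewrite polar_lc4r D1 D2 polar_self Fp; ring.
have Dvp a b : polar t (v a b 0 0) p = (r0 * a + r1 * b) * (q0 * a + q1 * b).
  have -> : polar t (v a b 0 0) p = polar t (v a b 0 0) (v 0 0 1 0) by rewrite /v -pE.
  by rewrite polar_lc4 B11 B12 B22 D1 D2 Fp; ring.
have Dvvp a b c d : polar3 t (v a b 0 0) (v c d 0 0) p =
    (r0 * a + r1 * b) * (q0 * c + q1 * d) + (r0 * c + r1 * d) * (q0 * a + q1 * b).
  have -> : polar3 t (v a b 0 0) (v c d 0 0) p = polar3 t (v a b 0 0) (v c d 0 0) (v 0 0 1 0).
    by rewrite /v -pE.
  by rewrite polar3_lc4 B11 B12 B22 D1 D2 Fp; ring.
case: (eqVneq (r0 * q1 - r1 * q0) 0) => [det0|det0]; last first.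
  set d := r0 * q1 - r1 * q0 in det0.
  (* The basis dual to the two linear factors, in which B becomes x y. *)
  apply: (@line_of_node (v (q1 / d) (- q0 / d) 0 0) (v (- r1 / d) (r0 / d) 0 0) p e4) => //.
  - apply: frv; have -> : q1 / d * (r0 / d) - - q0 / d * (- r1 / d) = d^-1 by rewrite /d; field.
    by rewrite invr_eq0.
  - by rewrite Dvp; field.
  - by rewrite Dvp; field.
  - by rewrite Dvvp /d; field.
have line_of_flex a b : (a != 0) || (b != 0) -> cub t (v a b 0 0) = 0 ->
    polar t (v a b 0 0) p = 0 -> exists u v, free [:: u; v] /\ line t u v.
  move=> ab0 Fv Dv; exists (v a b 0 0), p; split=> //.
  case: (eqVneq a 0) => [a0|a0].
    move: ab0; rewrite a0 eqxx /= => b0; apply: free13 (frv 0 b 1 0 _).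
    by rewrite mul0r sub0r oppr_eq0 mulr1.
  by apply: free13 (frv a b 0 1 _); rewrite mulr1 mulr0 subr0.
have [x [y [xy0 Fxy]]] := binary_cubic_zero (cub t e1) (polar t e1 e2) (polar t e2 e1) (cub t e2).
have Fxyv : cub t (v x y 0 0) = 0 by rewrite cub_lc4 -[RHS]Fxy; ring.
case: (boolP ((r0 != 0) || (r1 != 0))) => [r01|]; last first.
  rewrite negb_or !negbK => /andP[/eqP r00 /eqP r10].
  by apply: (line_of_flex x y); rewrite // Dvp r00 r10; ring.
have [a [b ab1]] : exists a b, r0 * a + r1 * b = 1.
  case: (eqVneq r0 0) r01 => [->|r00] /= r01; [exists 0, r1^-1|exists r0^-1, 0]; field => //.
have nE : q0 * r1 - q1 * r0 = 0 by rewrite -[RHS]oppr0 -det0; ring.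
(* The second factor is [kap] times the first. *)
set kap := q0 * a + q1 * b.
case: (eqVneq kap 0) => [kap0|kap0].
  apply: (line_of_flex x y) => //; rewrite Dvp.
  have -> : q0 * x + q1 * y = 0.
    have q00 : q0 = 0.
      apply: (eq_lincomb (m := r0) kap0); apply: (eq_lincomb (m := - q0) ab1).
      by apply: (eq_lincomb (m := b) nE); rewrite /kap; ring.
    have q10 : q1 = 0.
      apply: (eq_lincomb (m := r1) kap0); apply: (eq_lincomb (m := - q1) ab1).
      by apply: (eq_lincomb (m := - a) nE); rewrite /kap; ring.
    by rewrite q00 q10; ring.
  by rewrite mulr0.
(* Scaling (a, b) by [rho] gives B the value 1 there; the other basis vector will be the zero (r1,
   -r0) of B. *)
have [rho rhoE] := nth_root kap^-1 (isT : (0 < 2)%N).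
have rho0 : rho != 0.
  by apply: contra_neq kap0 => r0'; rewrite -[kap]invrK -rhoE r0' expr0n invr0.
apply: (@line_of_cusp (v (rho * a) (rho * b) 0 0) (v r1 (- r0) 0 0) p e4) => //.
- apply: frv.
  have -> : rho * a * - r0 - rho * b * r1 = - rho * (r0 * a + r1 * b) by ring.
  by rewrite ab1 mulr1 oppr_eq0.
- rewrite Dvp.
  have -> : (r0 * (rho * a) + r1 * (rho * b)) * (q0 * (rho * a) + q1 * (rho * b)) =
    rho ^+ 2 * (r0 * a + r1 * b) * kap by rewrite /kap; ring.
  by rewrite ab1 rhoE mulr1 mulVf.
- by rewrite Dvp; ring.
rewrite Dvvp.
have -> : q0 * r1 + q1 * - r0 = 0 by rewrite -[RHS]nE; ring.
by ring.
Qed.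

End Line.

(** * Tritangent planes *)

Section TritangentPlanes.

Variables (k : closedFieldType) (V : vectType k) (t : trilinear V).
Hypotheses (dimV : \dim {:V} = 4) (sm : smooth t).
Implicit Types (u v w p q r e n : V).

(** If the plane u, v, w is tangent along the line, the differential at a point n of the line is
    determined by its value on r. This value is a binary quadratic form in n, and a zero of it is a
    singular point. *)
Lemma no_double_line u v w r : free [:: u; v; w; r] -> line t u v ->
  polar t u w = 0 -> polar3 t u v w = 0 -> polar t v w = 0 -> False.
Proof.
move=> fr [Fu Fv Duv Dvu] Duw E Dvw.
have [x [y [xy0 Bxy]]] := binary_quadratic_zero (polar t u r) (polar3 t u v r) (polar t v r).
have [uE vE wE rE] := lc4_basis u v w r.
pose n := lc4 u v w r x y 0 0.
have n0 : n != 0 by apply: contraL xy0 => /eqP /(free4P _ _ _ _ fr)[-> -> _ _]; rewrite eqxx.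
suff : polar t n r != 0.
  have -> : polar t n r = polar t n (lc4 u v w r 0 0 0 1) by rewrite -rE.
  by rewrite polar_lc4 Fu Fv Duv Dvu Duw E Dvw -[X in _ != X]Bxy; apply/negP; rewrite negbK; apply/eqP; ring.
apply: (smooth_direction dimV sm fr n0).
- by rewrite cub_lc4 Fu Fv Duv Dvu; ring.
- have -> : polar t n u = polar t n (lc4 u v w r 1 0 0 0) by rewrite -uE.
  by rewrite polar_lc4 Fu Fv Duv Dvu; ring.
- have -> : polar t n v = polar t n (lc4 u v w r 0 1 0 0) by rewrite -vE.
  by rewrite polar_lc4 Fu Fv Duv Dvu; ring.
- have -> : polar t n w = polar t n (lc4 u v w r 0 0 1 0) by rewrite -wE.
  by rewrite polar_lc4 Fu Fv Duv Dvu Duw E Dvw; ring.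
Qed.

(* For a line u, v of the surface, the section by the plane of u, v, w is that line
   together with the conic whose coefficients appear here. *)
Definition plane_disc u v w := conic_disc (polar t u w) (polar3 t u v w)
  (polar t v w) (polar t w u) (polar t w v) (cub t w).
Definition tritangent u v w := conic_splits (polar t u w) (polar3 t u v w)
  (polar t v w) (polar t w u) (polar t w v) (cub t w).

(** The six coefficients have degrees 1, 1, 1, 2, 2, 3 in x, y, which makes the discriminant a
    quintic. *)
Lemma plane_disc_lc4 u v w r (x y : k) : line t u v ->
  plane_disc u v (lc4 u v w r 0 0 x y) =
  conic_disc (x * polar t u w + y * polar t u r)
    (x * polar3 t u v w + y * polar3 t u v r) (x * polar t v w + y * polar t v r)
    (x ^+ 2 * polar t w u + x * y * polar3 t u w r + y ^+ 2 * polar t r u)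
    (x ^+ 2 * polar t w v + x * y * polar3 t v w r + y ^+ 2 * polar t r v)
    (x ^+ 3 * cub t w + x ^+ 2 * y * polar t w r + x * y ^+ 2 * polar t r w + y ^+ 3 * cub t r).
Proof.
move=> [Fu Fv Duv Dvu]; rewrite /plane_disc !polar_lc4r cub_lc4 !(polar_self, Fu, Fv, Duv, Dvu).
have [uE vE wE rE] := lc4_basis u v w r.
set n := lc4 u v w r 0 0 x y.
have -> : polar3 t u v n = polar3 t (lc4 u v w r 1 0 0 0) (lc4 u v w r 0 1 0 0) n by rewrite -uE -vE.
have -> : polar t n u = polar t n (lc4 u v w r 1 0 0 0) by rewrite -uE.
have -> : polar t n v = polar t n (lc4 u v w r 0 1 0 0) by rewrite -vE.
rewrite polar3_lc4 !polar_lc4 !(Fu, Fv, Duv, Dvu).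
by congr conic_disc; ring.
Qed.

Lemma polyfun_plane_disc u v (w : k -> V) : polyvec w -> polyfun (fun x => plane_disc u v (w x)).
Proof.
have Pc := polyvec_const; move=> Pw; rewrite /plane_disc /conic_disc.
by do ![exact: polyfun_const|apply: polyfun_polar3|apply: polyfun_polar|apply: polyfun_cub|exact: Pc|exact: Pw
 |apply: polyfunN|apply: polyfunD|apply: polyfunX|apply: polyfunM].
Qed.

Lemma crossing_lines : exists u v w r,
  [/\ free [:: u; v; w; r], line t u v & line t u w].
Proof.
have [u [v [fruv luv]]] := line_exists dimV sm.
have [w [r [fr disc0]]] : exists w r, free [:: u; v; w; r] /\ plane_disc u v w = 0.
  have [w [r fr]] := free_extend2 dimV fruv.
  case: (eqVneq (plane_disc u v (lc4 u v w r 0 0 0 1)) 0) => [disc0|disc0].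
    exists r, w; split; last by have [_ _ _ ->] := lc4_basis u v w r.
    by rewrite (perm_free (Y := [:: u; v; w; r])) //; apply/permP => P /=; ring.
  have [||//|b b0|//|a a0] := root_of_reciprocal (f := fun a => plane_disc u v (lc4 u v w r 0 0 1 a))
      (g := fun b => plane_disc u v (lc4 u v w r 0 0 b 1)) (kappa := 1) (n := 5).
  - by apply: polyfun_plane_disc; apply: polyvec_lc4; polyfun_tac.
  - by apply: polyfun_plane_disc; apply: polyvec_lc4; polyfun_tac.
  - by rewrite !plane_disc_lc4 // /conic_disc; field.
  exists (lc4 u v w r 0 0 1 a), r; split=> //.
  have -> : [:: u; v; lc4 u v w r 0 0 1 a; r] =
    [:: lc4 u v w r 1 0 0 0; lc4 u v w r 0 1 0 0; lc4 u v w r 0 0 1 a; lc4 u v w r 0 0 0 1].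
    by have [<- <- _ <-] := lc4_basis u v w r.
  apply: free4_lc4 => // x y z x'; rewrite !(mulr0, mulr1, addr0, add0r).
  by move=> -> -> ->; rewrite !mul0r !add0r => ->.
have [p0 [p1 [p2 [q0 [q1 [q2 [[Duw E Dvw] Dwu Dwv Fw]]]]]]] := conic_disc0_splits disc0.
have [Fu Fv Duv Dvu] := luv.
(* The factor p is not the line u, v itself, as the plane is not tangent along that line. *)
have [s [s' ss1]] : exists s s', p0 * s + p1 * s' = 1.
  case: (eqVneq p0 0) => [p00|p00]; last by exists p0^-1, 0; field.
  case: (eqVneq p1 0) => [p10|p10]; last by exists 0, p1^-1; field.
  case: (no_double_line fr luv); first by rewrite Duw p00 mul0r.
    by rewrite E p00 p10; ring.
  by rewrite Dvw p10 mul0r.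
(* The common point of the two lines, a point of u, v where p takes the value 1, and w moved along
   that point into p = 0. *)
exists (lc4 u v w r p1 (- p0) 0 0), (lc4 u v w r s s' 0 0),
  (lc4 u v w r (- p2 * s) (- p2 * s') 1 0), (lc4 u v w r 0 0 0 1).
split.
- apply: free4_lc4 => // x y z x'; rewrite !(mulr0, mulr1, addr0, add0r) => h1 h2 z0 ->.
  have h1' : x * p1 + y * s = 0 by rewrite -[RHS]h1 z0; ring.
  have h2' : - x * p0 + y * s' = 0 by rewrite -[RHS]h2 z0; ring.
  have x0 : x = 0.
    apply: (eq_lincomb (m := - x) ss1); apply: (eq_lincomb (m := s') h1').
    by apply: (eq_lincomb (m := - s) h2'); ring.
  have y0 : y = 0.
    apply: (eq_lincomb (m := - y) ss1); apply: (eq_lincomb (m := p0) h1').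
    by apply: (eq_lincomb (m := p1) h2'); ring.
  by [].
- by split; rewrite ?cub_lc4 ?polar_lc4 Fu Fv Duv Dvu; ring.
split; rewrite ?cub_lc4 ?polar_lc4 !(Fu, Fv, Duv, Dvu, Duw, E, Dvw, Dwu, Dwv, Fw).
- by ring.
- apply: (eq_lincomb (m := - p2 * (- p2 * s * q0 - p2 * s' * q1 + q2)) ss1); ring.
- by ring.
- by apply: (eq_lincomb (m := - p2 * (q0 * p1 - q1 * p0)) ss1); ring.
Qed.

(* The derivative of the discriminant of the pencil of planes at a degenerate
   conic is -polar t n r, where n is the vertex of the conic, a singular point of
   the plane section.  Hence the plane of u, v, w is a simple root. *)
Lemma second_tritangent u v w r : free [:: u; v; w; r] -> line t u v -> line t u w ->
  exists s, tritangent u v (lc4 u v w r 0 0 s 1).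
Proof.
move=> fr luv luw; have [Fu Fv Duv Dvu] := luv; have [_ Fw Duw Dwu] := luw.
set n0 := polar3 t u v w; set n2 := polar t w v.
have [uE vE wE rE] := lc4_basis u v w r.
(* The plane section is y z (n0 x + n1 y + n2 z), with n1 = [polar t v w]; off the line z = 0 there
   remains a conic with vertex n. *)
pose n := lc4 u v w r n2 0 (- n0) 0.
have n_neq0 : n != 0.
  apply/negP => /eqP /(free4P _ _ _ _ fr)[n20 _ /eqP].
  rewrite oppr_eq0 => /eqP n00 _.
  (* If n0 = n2 = 0, the section contains the line u, w twice. *)
  apply: (no_double_line (v := w) (w := v) (r := r) _ luw) => //.
    by rewrite (perm_free (Y := [:: u; v; w; r])) //; apply/permP => P /=; ring.
  by rewrite -[RHS]n00 /n0 /polar3; ring.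
have Dnr : polar t n r != 0.
  apply: (smooth_direction dimV sm fr n_neq0).
  - by rewrite cub_lc4 Fu Fv Fw Duv Dvu Duw Dwu; ring.
  - have -> : polar t n u = polar t n (lc4 u v w r 1 0 0 0) by rewrite -uE.
    by rewrite polar_lc4 Fu Fv Fw Duv Dvu Duw Dwu; ring.
  - have -> : polar t n v = polar t n (lc4 u v w r 0 1 0 0) by rewrite -vE.
    by rewrite polar_lc4 Fu Fv Fw Duv Dvu Duw Dwu -/n0 -/n2; ring.
  - have -> : polar t n w = polar t n (lc4 u v w r 0 0 1 0) by rewrite -wE.
    by rewrite polar_lc4 Fu Fv Fw Duv Dvu Duw Dwu; ring.
have DnrE : polar t n r = n2 ^+ 2 * polar t u r - n0 * n2 * polar3 t u w r + n0 ^+ 2 * polar t w r.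
  have -> : polar t n r = polar t n (lc4 u v w r 0 0 0 1) by rewrite -rE.
  by rewrite polar_lc4 Fu Fv Fw Duv Dvu Duw Dwu; ring.
pose hornerP' := (hornerD, hornerN, hornerM, horner_exp, hornerMn, hornerC, hornerX,
  rmorph1, rmorph0, horner0).
pose derivP' := (derivD, derivN, derivM, derivXn, derivX, derivC, derivMn, expr2).
pose lin (c0 c1 : k) : {poly k} := c0%:P + c1%:P * 'X.
pose D : {poly k} := conic_disc (lin 0 (polar t u r)) (lin n0 (polar3 t u v r))
  (lin (polar t v w) (polar t v r)) ('X * lin (polar3 t u w r) (polar t r u))
  (lin n2 (polar3 t v w r) + (polar t r v)%:P * ('X * 'X))
  ('X * (lin (polar t w r) (polar t r w) + (cub t r)%:P * ('X * 'X))).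
have DE x : D.[x] = plane_disc u v (lc4 u v w r 0 0 1 x).
  rewrite plane_disc_lc4 // Fw Duw Dwu -/n0 -/n2 /D /lin /conic_disc.
  by rewrite !hornerP'; ring.
have D0 : root D 0.
  by apply/rootP; rewrite /D /lin /conic_disc !hornerP'; ring.
(* Dividing the quintic by the known plane leaves a quartic, nonzero at that plane; its root is a
   different plane. *)
have [Q DQ] := factor_theorem D 0 D0.
have Q0 : Q.[0] = - polar t n r.
  have -> : Q.[0] = D^`().[0] by rewrite DQ !derivP' !hornerP'; ring.
  by rewrite DnrE /D /lin /conic_disc !derivP' !hornerP'; ring.
have [||//|b b0||a a0] := root_of_reciprocal (f := fun a => plane_disc u v (lc4 u v w r 0 0 a 1))
    (g := fun b => Q.[b]) (kappa := 1) (n := 4).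
- by apply: polyfun_plane_disc; apply: polyvec_lc4; polyfun_tac.
- by exists Q.
- apply: (mulIf b0); have -> : Q.[b] * b = D.[b] by rewrite DQ !hornerP'; ring.
  by rewrite DE !plane_disc_lc4 // /conic_disc; field.
- by rewrite Q0 oppr_eq0.
by exists a; apply: conic_disc0_splits.
Qed.

(** The plane stays the same, only p2 and q2 change; this lets one fourth vector serve two
    tritangent planes. *)
Lemma tritangent_shift u v w (s : k) : line t u v -> tritangent u v w ->
  tritangent u v (lc4 u v w 0 0 s 1 0).
Proof.
move=> luv [p0 [p1 [p2 [q0 [q1 [q2 [[Duw E Dvw] Dwu Dwv Fw]]]]]]].
have [Fu Fv Duv Dvu] := luv.
exists p0, p1, (p2 + s * p1), q0, q1, (q2 + s * q1).
have [uE vE _ _] := lc4_basis u v w 0.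
set n := lc4 _ _ _ _ _ _ _ _.
have -> : polar3 t u v n = polar3 t (lc4 u v w 0 1 0 0 0) (lc4 u v w 0 0 1 0 0) n by rewrite -uE -vE.
have -> : polar t n u = polar t n (lc4 u v w 0 1 0 0 0) by rewrite -uE.
have -> : polar t n v = polar t n (lc4 u v w 0 0 1 0 0) by rewrite -vE.
rewrite polar3_lc4 !polar_lc4 !polar_lc4r cub_lc4 !(polar_self, Fu, Fv, Duv, Dvu, Duw, E, Dvw, Dwu, Dwv, Fw).
by split; [split|..]; ring.
Qed.

(** Adjusting r by w makes u, v, r tritangent; a further adjustment by v does the same for u, w, r
    and stays in the plane u, v, r. *)
Lemma tritangent_configuration : exists u v w r,
  [/\ free [:: u; v; w; r], line t u v, line t u w, tritangent u v r & tritangent u w r].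
Proof.
have [u [v [w [r [fr luv luw]]]]] := crossing_lines.
have [s tr] := second_tritangent fr luv luw.
set r1 := lc4 u v w r 0 0 s 1 in tr.
have fr1 : free [:: u; w; v; r1].
  rewrite (perm_free (Y := [:: u; v; w; r1])); last by apply/permP => P /=; ring.
  have -> : [:: u; v; w; r1] = [:: lc4 u v w r 1 0 0 0; lc4 u v w r 0 1 0 0;
      lc4 u v w r 0 0 1 0; r1] by have [<- <- <- _] := lc4_basis u v w r.
  apply: free4_lc4 => // x y z x'; rewrite !(mulr0, mulr1, addr0, add0r) => -> -> h x'0.
  by split=> //; rewrite -[RHS]h x'0 mul0r addr0.
have [s' tr'] := second_tritangent fr1 luw luv.
set r2 := lc4 u w v r1 0 0 s' 1 in tr'.
have r2E : r2 = lc4 u v r1 0 0 s' 1 0.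
  by rewrite /r2 /lc4 !scale0r !add0r !addr0.
exists u, v, w, r2; split=> //; last by rewrite r2E; apply: tritangent_shift.
have -> : [:: u; v; w; r2] = [:: lc4 u w v r1 1 0 0 0; lc4 u w v r1 0 0 1 0;
      lc4 u w v r1 0 1 0 0; r2] by have [<- <- <- _] := lc4_basis u w v r1.
apply: free4_lc4 => // x y z x'; rewrite !(mulr0, mulr1, addr0, add0r) => -> -> h x'0.
by split=> //; rewrite -[RHS]h x'0 mul0r addr0.
Qed.

End TritangentPlanes.

(** * The normal form *)

Section NormalForm.

Variables (k : closedFieldType) (V : vectType k) (t : trilinear V).
Hypotheses (dimV : \dim {:V} = 4) (sm : smooth t).

Lemma cayley_salmon_form : exists e0 e1 e2 e3 (b c : 'I_4 -> k),
  [/\ free [:: e0; e1; e2; e3], [/\ b 0 != 0, b 1 != 0, c 2%:R != 0 & c 3%:R != 0] &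
  forall x0 x1 x2 x3, cub t (lc4 e0 e1 e2 e3 x0 x1 x2 x3) =
    x0 * x1 * (b 0 * x0 + b 1 * x1 + b 2%:R * x2 + b 3%:R * x3) +
    x2 * x3 * (c 0 * x0 + c 1 * x1 + c 2%:R * x2 + c 3%:R * x3)].
Proof.
have [u [v [w [r [fr luv luw]]]]] := tritangent_configuration dimV sm.
have [Fu Fv Duv Dvu] := luv; have [_ Fw Duw Dwu] := luw.
move=> [p0 [p1 [p2 [q0 [q1 [q2 [[Dur Euvr Dvr] Dru Drv Fr]]]]]]].
(* The differential at u vanishes on u, v and w, so smoothness makes its value on r nonzero. *)
have g0 : p0 * q0 != 0.
  rewrite -Dur; apply: (smooth_direction dimV sm fr) => //; last by rewrite polar_self Fu mulr0.
  apply/eqP => u0; have [uE _ _ _] := lc4_basis u v w r.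
  have /(free4P _ _ _ _ fr)[/eqP] : lc4 u v w r 1 0 0 0 = 0 by rewrite -uE.
  by rewrite oner_eq0.
move=> tri2.
(* The factorizations in the planes u, v, r and u, w, r agree on the line u, r; after rescaling and
   possibly exchanging, they glue to m2 = p0 x + p1 y + p3 z + p2 t and m3 = q0 x + q1 y + q3 z + q2
   t. *)
have [p3 [q3 [Dwr Euwr Drw]]] : exists p3 q3, [/\ polar t w r = p3 * q3,
    polar3 t u w r = p0 * q3 + p3 * q0 & polar t r w = p3 * q2 + p2 * q3].
  move: tri2 => [p0' [p1' [p2' [q0' [q1' [q2' [[Dur' Euwr Dwr] Dru' Drw Fr']]]]]]].
  have [||||c c0 [[p0E p2E q0E q2E]|[q0E q2E p0E p2E]]] := @binary_factors_match k p0 p2 q0 q2 p0' p2' q0' q2'.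
  - by [].
  - by rewrite -Dur.
  - by rewrite -Dru.
  - by rewrite -Fr.
  - exists (p1' / c), (q1' * c).
    by rewrite Dwr Euwr Drw p0E p2E q0E q2E; split; field.
  - exists (q1' / c), (p1' * c).
    by rewrite Dwr Euwr Drw p0E p2E q0E q2E; split; field.
move: (g0); rewrite mulf_eq0 negb_or => /andP[p00 q00].
pose f := lc4 u v w r.
pose n0 := polar3 t u v w; pose n1 := polar t v w; pose n2 := polar t w v.
(* The coefficient of y z t left after subtracting t m2 m3. *)
pose n3 := polar3 t v w r - p1 * q3 - p3 * q1.
(* The basis dual to the coordinates y, z, t, m2. *)
pose e0 := f (- p1 / p0) 1 0 0; pose e1 := f (- p3 / p0) 0 1 0.
pose e2 := f (- p2 / p0) 0 0 1; pose e3 := f p0^-1 0 0 0.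
have fre : free [:: e0; e1; e2; e3].
  apply: free4_lc4 => // a b c d; rewrite !(mulr0, mulr1, addr0, add0r).
  move=> + b0 c0 d0; rewrite b0 c0 d0 !mul0r !add0r => /eqP.
  by rewrite mulf_eq0 invr_eq0 (negPf p00) orbF => /eqP.
have fre_perm X : perm_eq X [:: e0; e1; e2; e3] -> free X by move=> /perm_free ->.
pose values := (Fu, Fv, Fw, Duv, Dvu, Duw, Dwu, Dur, Euvr, Dvr, Dru, Drv, Fr, Dwr, Euwr, Drw).
have e_neq0 : forall i, i \in [:: e0; e1; e2; e3] -> i != 0 by move=> i; apply: free_not0.
exists e0, e1, e2, e3.
(* The values at this basis of l3 = n0 x + n1 y + n2 z + n3 t, and then of m3. *)
exists (fun i => [:: n1 - n0 * p1 / p0; n2 - n0 * p3 / p0; n3 - n0 * p2 / p0; n0 / p0]`_i).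
exists (fun i => [:: q1 - q0 * p1 / p0; q3 - q0 * p3 / p0; q2 - q0 * p2 / p0; q0 / p0]`_i).
split=> //=; last first.
  move=> x0 x1 x2 x3; rewrite lc4_lc4 cub_lc4 !values.
  by rewrite /n3 /n2 /n1 /n0; field.
split.
- have -> : n1 - n0 * p1 / p0 = polar t e0 e1.
    by rewrite polar_lc4 !values /n0 /n1; field.
  apply: (smooth_direction dimV sm (e1 := e0) (e2 := e2) (e3 := e3)).
  + by apply: fre_perm; apply/permP => P /=; ring.
  + by apply: e_neq0; rewrite !inE eqxx ?orbT.
  + by rewrite cub_lc4 !values; field.
  + by rewrite polar_lc4 !values; field.
  + by rewrite polar_lc4 !values; field.
  + by rewrite polar_lc4 !values; field.
- have -> : n2 - n0 * p3 / p0 = polar t e1 e0.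
    by rewrite polar_lc4 !values /n0 /n2; field.
  apply: (smooth_direction dimV sm (e1 := e1) (e2 := e2) (e3 := e3)).
  + by apply: fre_perm; apply/permP => P /=; ring.
  + by apply: e_neq0; rewrite !inE eqxx ?orbT.
  + by rewrite cub_lc4 !values; field.
  + by rewrite polar_lc4 !values; field.
  + by rewrite polar_lc4 !values; field.
  + by rewrite polar_lc4 !values; field.
- have -> : q2 - q0 * p2 / p0 = polar t e2 e3.
    by rewrite polar_lc4 !values; field.
  apply: (smooth_direction dimV sm (e1 := e2) (e2 := e0) (e3 := e1)).
  + by apply: fre_perm; apply/permP => P /=; ring.
  + by apply: e_neq0; rewrite !inE eqxx ?orbT.
  + by rewrite cub_lc4 !values; field.
  + by rewrite polar_lc4 !values; field.
  + by rewrite polar_lc4 !values; field.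
  + by rewrite polar_lc4 !values; field.
- by rewrite mulf_neq0 ?invr_eq0.
Qed.

Lemma normal_form_basis : exists e0 e1 e2 e3 (a0 a1 a2 a3 : k),
  free [:: e0; e1; e2; e3] /\ forall x0 x1 x2 x3,
  cub t (lc4 e0 e1 e2 e3 x0 x1 x2 x3) =
    x0 * x1 * (x0 + x1 + a3 * x2 + a2 * x3) +
    x2 * x3 * (a1 * x0 + a0 * x1 + x2 + x3).
Proof.
have [e0 [e1 [e2 [e3 [b [c [fr [b0 b1 c2 c3] FE]]]]]]] := cayley_salmon_form.
(* With t0 = s b1 and t1 = s b0, both t0^2 t1 b0 and t0 t1^2 b1 equal s^3 b0^2 b1^2, so one cube
   root normalizes two coefficients; likewise for s'. *)
have [s sE] := nth_root (b 0 ^+ 2 * b 1 ^+ 2)^-1 (isT : (0 < 3)%N).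
have [s' s'E] := nth_root (c 2%:R ^+ 2 * c 3%:R ^+ 2)^-1 (isT : (0 < 3)%N).
have s0 : s != 0.
  by apply: contra_eq_neq sE => ->; rewrite expr0n eq_sym invr_neq0 ?mulf_neq0 ?expf_neq0.
have s'0 : s' != 0.
  by apply: contra_eq_neq s'E => ->; rewrite expr0n eq_sym invr_neq0 ?mulf_neq0 ?expf_neq0.
pose t0 := s * b 1; pose t1 := s * b 0; pose t2 := s' * c 3%:R; pose t3 := s' * c 2%:R.
pose f := lc4 e0 e1 e2 e3.
exists (f t0 0 0 0), (f 0 t1 0 0), (f 0 0 t2 0), (f 0 0 0 t3).
exists (t1 * t2 * t3 * c 1), (t0 * t2 * t3 * c 0), (t0 * t1 * t3 * b 3%:R), (t0 * t1 * t2 * b 2%:R).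
split=> [|x0 x1 x2 x3].
  apply: free4_lc4 => // x y z w; rewrite !(mulr0, mulr1, addr0, add0r).
  move=> /eqP + /eqP + /eqP + /eqP; rewrite !mulf_eq0.
  rewrite (negPf s0) (negPf s'0) (negPf b0) (negPf b1) (negPf c2) (negPf c3) !orbF.
  by move=> /eqP-> /eqP-> /eqP-> /eqP->.
have E1 : s ^+ 3 * (b 0 ^+ 2 * b 1 ^+ 2) = 1 by rewrite sE mulVf ?mulf_neq0 ?expf_neq0.
have E2 : s' ^+ 3 * (c 2%:R ^+ 2 * c 3%:R ^+ 2) = 1 by rewrite s'E mulVf ?mulf_neq0 ?expf_neq0.
rewrite lc4_lc4 FE.
apply: (eq_lincomb (m := x0 * x1 * (x0 + x1)) E1).
apply: (eq_lincomb (m := x2 * x3 * (x2 + x3)) E2).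
by rewrite /t0 /t1 /t2 /t3; ring.
Qed.

End NormalForm.

(** * From pointwise to polynomial identities *)

Lemma mpoly_eq0_of_meval (k : closedFieldType) n (p : {mpoly k[n]}) :
  (forall v, p.@[v] = 0) -> p = 0.
Proof.
elim: n p => [|n IHn] p p0.
  have := p0 (fun=> 0); rewrite [p]nvar0_mpolyC mevalC => ->.
  exact: mpolyC0.
(* Induction on the variables: [muni p] is p as a polynomial in the last variable, and a nonzero
   specialization of it would have a nonroot c. *)
pose w : 'I_n -> 'I_n.+1 := widen_ord (leqnSn n); pose tr (m : 'X_{1..n.+1}) := [multinom m (w i) | i < n].
have coef_muni m : (muni p)`_(m ord_max) @_(tr m) = p@_m.
  rewrite muniE coef_sum [in RHS](mpolyE p) !raddf_sum /=; apply: eq_bigr => m' _.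
  rewrite coefZ coefXn mcoeffZ mcoeffX.
  have [->|m'm] := eqVneq m' m; first by rewrite !eqxx mulr1 mcoeffZ mcoeffX eqxx.
  have [mo|_] := eqVneq (m ord_max) (m' ord_max); last by rewrite mulr0 mcoeff0 mulr0.
  rewrite mulr1 mcoeffZ mcoeffX; case: eqP => // trE; case/eqP: m'm.
  apply/mnmP => i; have [j ij|ij] := unliftP ord_max i; last by rewrite ij mo.
  have -> : i = w j by rewrite ij; apply: val_inj; rewrite /= /bump leqNgt ltn_ord.
  by move/mnmP/(_ j): trE; rewrite !mnmE.
have muni_eval (v : 'I_n.+1 -> k) : p.@[v] = (map_poly (meval (v \o w)) (muni p)).[v ord_max].
  rewrite mevalE muniE raddf_sum horner_sum; apply: eq_bigr => m _.
  rewrite /= map_polyZ hornerZ map_polyXn hornerXn /= mevalZ mevalX big_ord_recr /= mulrA.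
  by congr (_ * _ * _); apply: eq_bigr => i _; rewrite mnmE.
suff muni0 j : (muni p)`_j = 0 by apply/mpolyP => m; rewrite -coef_muni muni0 !mcoeff0.
apply: IHn => v; rewrite -coef_map /=.
suff -> : map_poly (meval v) (muni p) = 0 by rewrite coef0.
apply/eqP; apply: contraT => /closed_nonrootP[c].
pose v' i := if unlift ord_max i is Some j then v j else c.
have vw : v' \o w =1 v.
  move=> l; rewrite /v' /= (_ : w l = lift ord_max l) ?liftK //.
  by apply: val_inj; rewrite /= /bump leqNgt ltn_ord.
have := muni_eval v'; rewrite p0 {2}/v' unlift_none => E.
suff -> : map_poly (meval v) (muni p) = map_poly (meval (v' \o w)) (muni p).
  by rewrite /root -E eqxx.
by apply: eq_map_poly => q; apply: meval_eq => l; rewrite vw.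
Qed.

(** * Cubic polynomials as trilinear forms *)

Section SurfaceTrilinear.

Variable k : closedFieldType.
Let V := 'cV[k]_4.

(** The clause on partial derivatives turns the Jacobian criterion for F into [smooth t]. *)
Definition represents (t : trilinear V) (F : {mpoly k[4]}) :=
  forall x : V, cub t x = F.@[fun i => x i 0] /\
    forall i, polar t x (delta_mx i 0) = (F^`M(i)).@[fun j => x j 0].

Lemma represents0 : exists t, represents t 0.
Proof.
unshelve eexists; first by apply: (@Trilinear k V (fun _ _ _ => 0)) => *; ring.
by move=> x; split=> [|i]; rewrite ?mderiv0 meval0 // /polar /= !addr0.
Qed.

Lemma representsZD c t1 t2 F1 F2 : represents t1 F1 -> represents t2 F2 ->
  exists t, represents t (c *: F1 + F2).
Proof.
move=> r1 r2; unshelve eexists.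
  apply: (@Trilinear k V (fun x y z => c * t1 x y z + t2 x y z)) => *;
    rewrite ?triP1 ?triP2 ?triP3; ring.
move=> x; have [F1E D1E] := r1 x; have [F2E D2E] := r2 x.
split=> [|i]; first by rewrite mevalD mevalZ -F1E -F2E.
by rewrite mderivD mderivZ mevalD mevalZ -D1E -D2E /polar /=; ring.
Qed.

(** Ordering the three factors gives a trilinear lift without dividing by 6, in every
    characteristic. *)
Lemma represents_monomial (i j l : 'I_4) : exists t, represents t ('X_i * 'X_j * 'X_l).
Proof.
unshelve eexists.
  by apply: (@Trilinear k V (fun x y z => x i 0 * y j 0 * z l 0)) => *;
    rewrite !mxE; ring.
move=> x; split=> [|r]; first by rewrite !mevalM !mevalXU.
have dX s : (('X_s)^`M(r)).@[fun j0 => x j0 0] = (delta_mx r 0 : V) s 0.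
  rewrite mderivX mevalZ mxE andbT mnm1E; case: eqVneq => [->|]; last by rewrite mul0r.
  have -> : (U_(r) - U_(r) = 0)%MM by apply/mnmP => l'; rewrite mnmBE subnn mnm0E.
  by rewrite mpolyX0 meval1 mulr1.
by rewrite !mderivM !(mevalD, mevalM, mevalXU) !dX /polar /=; ring.
Qed.

Lemma mdeg3P (m : 'X_{1..4}) : mdeg m = 3 -> exists i j l, m = (U_(i) + U_(j) + U_(l))%MM.
Proof.
have split1 (m' : 'X_{1..4}) d : mdeg m' = d.+1 -> exists i m1, m' = (U_(i) + m1)%MM /\ mdeg m1 = d.
  move=> m'd; have [i m'i] : exists i, m' i != 0%N.
    apply/existsP; apply: contra_eqT m'd; rewrite negb_exists => /forallP m'0.
    by rewrite mdegE big1 // => i _; apply/eqP; move: (m'0 i); rewrite negbK.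
  have m'E : (U_(i) + (m' - U_(i)))%MM = m' by rewrite addmC submK // lep1mP.
  exists i, (m' - U_(i))%MM; split=> //.
  by move: m'd; rewrite -{1}m'E mdegD mdeg1 add1n => -[].
move=> /split1[i [m1 [-> /split1[j [m2 [-> /eqP/mdeg1P[l /eqP->]]]]]]].
by exists i, j, l; rewrite addmA.
Qed.

Lemma cubic_represented (F : {mpoly k[4]}) : F \is 3.-homog -> exists t, represents t F.
Proof.
move=> /dhomogP hF; rewrite [F]mpolyE.
have : {in msupp F, forall m, mdeg m = 3} by move=> m /hF.
elim: (msupp F) => [|m s IH] hs; first by rewrite big_nil; apply: represents0.
have [t2 r2] := IH (fun m' m's => hs m' (mem_behead (s := m :: s) m's)).
have [i [j [l mE]]] := mdeg3P (hs m (mem_head m s)).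
have [t1 r1] := represents_monomial i j l.
by rewrite big_cons mE !mpolyXD; apply: representsZD r1 r2.
Qed.

End SurfaceTrilinear.

(** * The projective isomorphism *)

Theorem theorem1p1 (k : closedFieldType) (F : {mpoly k[4]}) :
  cubic_form F -> nonsingular F ->
  exists a0 a1 a2 a3 : k,
    projectively_isomorphic F (normal_form a0 a1 a2 a3).
Proof.
move=> [_ F3] Fns; have [t tF] := cubic_represented F3.
have sm : smooth t.
  move=> v v0 tv; have [i] : exists i, (F^`M(i)).@[fun j => v j 0] != 0.
    by apply: Fns; split=> //; have [<-] := tF v.
  by have [_ <-] := tF v; exists (delta_mx i 0).
have dimV : \dim {:'cV[k]_4} = 4 by rewrite dimvf dim_matrix.
have [e0 [e1 [e2 [e3 [a0 [a1 [a2 [a3 [fr tE]]]]]]]]] := normal_form_basis dimV sm.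
exists a0, a1, a2, a3; set G := normal_form a0 a1 a2 a3.
(* The columns of M are the new basis, so G is F composed with M, and the inverse of M carries F to
   G. *)
pose M : 'M[k]_4 := \matrix_(i, j) [:: e0; e1; e2; e3]`_j i 0.
have Mlc x : M *m x = lc4 e0 e1 e2 e3 (x 0 0) (x 1 0) (x 2%:R 0) (x 3%:R 0).
  apply/colP => i; rewrite !mxE !big_ord_recl big_ord0 addr0 !mxE /=.
  by rewrite !addrA; congr (_ + _ + _ + _); rewrite mulrC; congr (x _ _ * _); apply: val_inj.
have GE (x : 'cV[k]_4) : G.@[fun i => x i 0] = F.@[fun i => (M *m x) i 0].
  have [<- _] := tF (M *m x); rewrite Mlc tE.
  by rewrite /G /normal_form !(mevalD, mevalM, mevalZ, mevalXU).
have Munit : M \in unitmx.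
  rewrite -unitmx_tr unitmxE unitfE; apply/negP => /det0P[y y0 yM].
  have My : M *m y^T = 0 by rewrite -[M]trmxK -trmx_mul yM trmx0.
  move: y0 => /eqP; apply; rewrite -[y]trmxK; apply/rowP => i.
  move: My; rewrite Mlc => /(free4P _ _ _ _ fr)[h0 h1 h2 h3].
  rewrite mxE [RHS]mxE; case: i => [[|[|[|[|//]]]] i].
  - by rewrite -[RHS]h0; congr (_ _ _); apply: val_inj.
  - by rewrite -[RHS]h1; congr (_ _ _); apply: val_inj.
  - by rewrite -[RHS]h2; congr (_ _ _); apply: val_inj.
  - by rewrite -[RHS]h3; congr (_ _ _); apply: val_inj.
exists (invmx M); first by rewrite unitmx_inv.
have GAE (x : 'cV[k]_4) : G.@[fun i => (invmx M *m x) i 0] = F.@[fun i => x i 0].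
  by rewrite GE mulKVmx.
split.
  move=> y; split=> [[y0 Gy]|[x [x0 Fx] ->]].
    exists (M *m y); last by rewrite mulKmx.
    split; last by rewrite -GE.
    by apply: contra_neq y0 => My0; rewrite -[y](mulKmx Munit) My0 mulmx0.
  split; last by rewrite GAE.
  by apply: contra_neq x0 => Mx0; rewrite -[x](mulKVmx Munit) Mx0 mulmx0.
(* The scheme equality: the pullback and F take the same values by [GAE], hence are equal
   polynomials. *)
exists 1; rewrite ?oner_neq0 // scale1r; apply/eqP; rewrite -subr_eq0; apply/eqP.
apply: mpoly_eq0_of_meval => v; rewrite mevalB comp_mpoly_meval.
pose x : 'cV[k]_4 := \col_i v i.
have -> : F.@[v] = F.@[fun i => x i 0] by apply: meval_eq => i; rewrite mxE.
rewrite -GAE; apply/eqP; rewrite subr_eq0; apply/eqP; apply: meval_eq => i.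
rewrite tnth_mktuple raddf_sum mxE; apply: eq_bigr => j _.
by rewrite /= mevalZ mevalXU mxE.
Qed.
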